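(* Let $n,r$ be integers with $0\leq r\leq \frac{n+3}{2}$ and let $G\in\mathcal{U}_{n,r}$. Then $W(G)$ is minimum among all graphs in $\mathcal{U}_{n,r}$ if and only if $G$ is one of the following: (a) $H(K_2,K_1,K_1,K_1,K_1)$, or $H(SB(1;b_1),X_1,X_2)$ where $b_1\geq 1$ is odd and $X_j\in\{K_1,K_2\}$ for each $j=1,2$; (b) $H(SB(1;b_2),K_1,K_1)$, $H(SB(1;b_3),K_1,K_1,K_1)$, or $H(SaB(2;b_4),K_1,K_1,K_1,K_1)$, where $b_i$ is even for each $i=2,3,4$.
   Context: All graphs are finite and simple. For a connected graph $G$, the Wiener index is $W(G)=\sum_{\{u,v\}\subseteq V(G)} d(u,v)$, the sum of distances over all unordered pairs of distinct vertices. A graph is unicyclic if it is connected and contains exactly one cycle. $\mathcal{U}_{n,r}$ denotes the set of unicyclic graphs with $n$ vertices of which exactly $r$ have even degree. If $G$ is unicyclic with cycle $C=v_1v_2\dots v_\ell v_1$, then each component of $G-E(C)$ is a tree $T_i$ containing exactly one cycle vertex $v_i$, regarded as rooted at $v_i$; one writes $G=H(T_1,T_2,\dots,T_\ell)$ (the trees listed in cyclic order around the cycle, each $T_i$ attached to the cycle at its root). $K_1$ denotes a single vertex, and $K_2$ a single edge rooted at one of its endpoints (a pendant edge). A subdivided star with center $u$ is a tree obtained from a star with center $u$ by inserting degree-2 vertices into its edges; its branches are the paths from $u$ to its leaves, and the length of a branch is its number of edges. $SB(t;b)$ is the subdivided star with $b$ branches each of length exactly $t$ (so $SB(1;b)$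 is the star with $b$ leaves); $SaB(t;b)$ is a subdivided star with $b$ branches, each of length $t$ or $t-1$, at least one of length $t$. When such a star appears as an argument of $H$, it is rooted at its center.
   Formalization: SaB(2;b) is allowed to have all branches of length 1 (the clause ''at least one of length t'' is dropped); with that clause the claim fails for r = 5, e.g. n = 7, where the minimizer H(SB(1;2),K_1,K_1,K_1,K_1) would not be listed. *)

(* Defs.v *)
From HB Require Import structures.
From mathcomp Require Import all_boot.

Set Implicit Arguments.
Unset Strict Implicit.
Unset Printing Implicit Defensive.

Record sgraph := SGraph {
  vertex :> finType;
  adj : rel vertex;
  adj_sym : symmetric adj;
  adj_irrefl : irreflexive adj }.

Record rooted_graph := RootedGraph { rg_graph :> sgraph; rg_root : rg_graph }.

Definition iso (G H : sgraph) : Prop :=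
  exists2 f : G -> H, bijective f & forall x y, adj (f x) (f y) = adj x y.

Notation "G ~= H" := (iso G H) (at level 70).

Section Invariants.
Variable G : sgraph.

Definition deg (v : G) : nat := #|[pred w | adj v w]|.

Definition connected : Prop := forall u v : G, connect (@adj G) u v.

Definition has_walk (u v : G) (k : nat) : bool :=
  [exists p : k.-tuple G, path (@adj G) u p && (last u p == v)].

(* The least length of a walk from u to v; a shortest walk in a connected graph
   has fewer than #|G| edges, so the junk value #|G| only occurs between
   different components. *)
Definition dist (u v : G) : nat := find (has_walk u v) (iota 0 #|G|).

(* Ordering the pairs by rank selects each unordered pair of distinct vertices
   exactly once. *)
Definition wiener : nat :=
  \sum_(p : G * G | enum_rank p.1 < enum_rank p.2) dist p.1 p.2.

Definition is_cycle (c : seq G) : bool := (2 < size c) && ucycleb (@adj G) c.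

Definition cycle_edges (c : seq G) : {set {set G}} :=
  [set [set x; next c x] | x in c].

(* Cycles are counted as subgraphs, i.e. through their edge sets, since one
   cycle is traversed by many cyclic sequences. *)
Definition unicyclic : Prop :=
  connected /\
  exists! E : {set {set G}}, exists2 c : seq G, is_cycle c & E = cycle_edges c.

End Invariants.

Definition in_U (n r : nat) (G : sgraph) : Prop :=
  [/\ unicyclic G, #|G| = n & #|[pred v : G | ~~ odd (deg v)]| = r].

Section CompleteGraph.
Variable n : nat.
Definition complete_adj : rel 'I_n.+1 := fun i j => i != j.

Lemma complete_sym : symmetric complete_adj.
Proof. by move=> i j; rewrite /complete_adj eq_sym. Qed.

Lemma complete_irrefl : irreflexive complete_adj.
Proof. by move=> i; rewrite /complete_adj eqxx. Qed.

(* The complete graph on n.+1 vertices; all choices of the root are equivalent. *)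
Definition rcomplete : rooted_graph :=
  @RootedGraph (SGraph complete_sym complete_irrefl) ord0.
End CompleteGraph.

Definition K1 : rooted_graph := rcomplete 0.
Definition K2 : rooted_graph := rcomplete 1.

(* The subdivided star whose branches have the lengths listed in ls: None is the
   center, and (i, j) is the vertex at distance j.+1 from it on branch i. *)
Section SubdividedStar.
Variable ls : seq nat.

Definition star_vertex : finType :=
  option {i : 'I_(size ls) & 'I_(nth 0 ls i)}.

Definition star_adj : rel star_vertex := fun x y =>
  match x, y with
  | None, None => false
  | None, Some v => tagged v == 0 :> nat
  | Some u, None => tagged u == 0 :> nat
  | Some u, Some v =>
      (tag u == tag v) &&
      (((tagged u).+1 == tagged v :> nat) || ((tagged v).+1 == tagged u :> nat))
  end.

Lemma star_sym : symmetric star_adj.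
Proof. by move=> [u|] [v|] //=; rewrite eq_sym orbC. Qed.

Lemma star_irrefl : irreflexive star_adj.
Proof. by move=> [u|] //=; rewrite orbb gtn_eqF // andbF. Qed.

Definition subdivided_star : rooted_graph :=
  @RootedGraph (SGraph star_sym star_irrefl) None.
End SubdividedStar.

Definition SB (t b : nat) : rooted_graph := subdivided_star (nseq b t).

(* T is an SaB(t;b).  All branches may have length t - 1: if a branch of length t
   were required, no SaB(2;b) would cover the graphs H(SB(1;b),K1,K1,K1,K1) with
   b >= 2 even, which are the minimizers with exactly five even vertices. *)
Definition is_SaB (t b : nat) (T : rooted_graph) : Prop :=
  exists ls : seq nat,
    [/\ size ls = b,
        all (fun l => (0 < l) && ((l == t) || (l.+1 == t))) ls
      & T = subdivided_star ls].

(* H(T_1,...,T_l): the disjoint union of the T_i, plus edges joining the roots of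
   cyclically consecutive ones.  It is the intended graph when 3 <= size ts. *)
Section CycleOfTrees.
Variable ts : seq rooted_graph.

Definition H_vertex : finType :=
  {i : 'I_(size ts) & vertex (nth K1 ts i)}.

Definition at_root (x : H_vertex) : bool :=
  tagged x == rg_root (nth K1 ts (tag x)).

Definition consecutive : rel 'I_(size ts) := fun i j =>
  (i != j) && ((ordS i == j) || (ordS j == i)).

Definition H_adj : rel H_vertex := fun x y =>
  (tag x == tag y) && adj (tagged x) (tagged_as x y)
  || [&& at_root x, at_root y & consecutive (tag x) (tag y)].

Lemma H_sym : symmetric H_adj.
Proof.
move=> x y; rewrite /H_adj; congr orb.
  case: x y => [i u] [j v] /=; case: (eqVneq i j) => [e|//] /=.
  by subst j; rewrite !tagged_asE adj_sym.
by rewrite andbCA /consecutive eq_sym orbC.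
Qed.

Lemma H_irrefl : irreflexive H_adj.
Proof.
by case=> i u; rewrite /H_adj /consecutive /= !eqxx tagged_asE adj_irrefl !andbF.
Qed.

Definition H : sgraph := SGraph H_sym H_irrefl.
End CycleOfTrees.

(* Main.v *)
Require Import Defs.
From HB Require Import structures.
From mathcomp Require Import all_boot.
From mathcomp Require Import zify.

Set Implicit Arguments.
Unset Strict Implicit.
Unset Printing Implicit Defensive.

(** Orient every edge of a unicyclic graph along the cycle or towards it, so that
    the graph becomes the graph of a function [f].  If [s x] is the number of
    vertices in the subtree below a vertex [x] off the cycle, and [w_i] the number
    of vertices in the tree at the [i]-th cycle vertex, then
      [2 W = 2 \sum_x s x * (n - s x) + \sum_(i, j) w_i w_j d(i, j)],
    where [d] is the distance on the cycle.  The terms of the first sum are [n - 1]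
    at the leaves, of which there are at most [n - r] because leaves are odd, and
    at least [2 (n - 2)] elsewhere, with equality when [s x = 2].  The second sum
    is smallest when all trees but one are trivial.  Comparing the resulting bounds
    for the various cycle lengths gives the minimum, and its equality cases are the
    graphs of the theorem.  For [r <= 1] parity forces nontrivial trees on the cycle,
    which is why the weights [w_i] have to be kept in the bound. *)

(** * Distances and isomorphism invariance *)

(** An orientation is the common interface: an arbitrary unicyclic graph and an explicit [H ts] both
    receive one, so the lower bound and the values of the listed graphs come from the same distance
    formula. The comparisons are made for 2W: sums over ordered pairs need no order on the vertices,
    and [cyc_sum l], the floor of l^2/4, enters through [4 * cyc_sum l + odd l = l * l] without
    division. Minimality compares G only with other graphs, so a number has to stand in between:
    [min_wiener n r] is a lower bound, equality forces the listed shapes, each listed shape attains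
    it, and it is attained whenever the class is nonempty and 2r <= n + 3. The condition 2r <= n + 3
    acts in three places: it excludes bare cycles of length above 3, it leaves enough branches to
    carry r - 5 vertices of subtree size 2, and it makes the five-cycle strictly better than the
    six-cycle. *)

Lemma has_walkP (G : sgraph) (u v : G) k :
  reflect (exists p : seq G, [/\ size p = k, path (@adj G) u p & last u p = v])
          (has_walk u v k).
Proof.
apply: (iffP existsP) => [[p /andP[up /eqP pv]]|[p [pk up pv]]].
  by exists p; rewrite size_tuple.
by move/eqP: pk => pk; exists (Tuple pk); rewrite /= up pv eqxx.
Qed.

Lemma dist_le_walk (G : sgraph) (u : G) p :
  path (@adj G) u p -> dist u (last u p) <= size p.
Proof.
move=> up; rewrite /dist; have [lpG|] := ltnP (size p) #|G|; last first.
  by apply: leq_trans; rewrite -{2}(size_iota 0 #|G|) find_size.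
rewrite leqNgt; apply/negP => /(before_find 0); rewrite nth_iota //= add0n.
by move/negbT/negP; apply; apply/has_walkP; exists p.
Qed.

(** The scan in [dist] stops before [#|G|], so k must be shown to be in range: removing repetitions
    from [q] leaves fewer than [#|G|] edges, and minimality bounds k by their number. *)
Lemma dist_eq (G : sgraph) (u : G) q k :
  path (@adj G) u q -> size q <= k ->
  (forall p, path (@adj G) u p -> last u p = last u q -> k <= size p) ->
  dist u (last u q) = k.
Proof.
move=> uq qk kmin; apply/eqP; rewrite eqn_leq (leq_trans (dist_le_walk uq)) //=.
have k_lt : k < #|G|.
  move: kmin {qk}; case/shortenP: uq => q' uq' Uq' _ kmin.
  apply: leq_ltn_trans (kmin q' uq' (erefl _)) _.
  by have := max_card (mem (u :: q')); rewrite (card_uniqP Uq').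
rewrite leqNgt; apply/negP => lt_dk.
have: has (has_walk u (last u q)) (iota 0 #|G|).
  by rewrite has_find size_iota (ltn_trans lt_dk).
move/(nth_find 0); rewrite nth_iota ?(ltn_trans lt_dk) //= add0n.
case/has_walkP => p [sp up lp]; have := kmin p up lp.
by rewrite sp leqNgt lt_dk.
Qed.

Lemma path_rev_adj (G : sgraph) (u : G) p : path (@adj G) u p ->
  exists q, [/\ path (@adj G) (last u p) q, last (last u p) q = u & size q = size p].
Proof.
move=> up; exists (rev (belast u p)); split.
- rewrite (eq_path (e' := fun x y => adj y x)); first by rewrite rev_path.
  by move=> x y; rewrite adj_sym.
- by case: p up => //= a p _; rewrite rev_cons last_rcons.
- by rewrite size_rev size_belast.
Qed.

Lemma dist_sym (G : sgraph) (u v : G) : dist u v = dist v u.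
Proof.
rewrite /dist; apply: eq_find => k; apply/has_walkP/has_walkP => -[p [sp up lp]];
  have [q [vq lq sq]] := path_rev_adj up; exists q; rewrite -lp ?sq ?lq //.
Qed.

(** Ordered pairs eliminate [enum_rank], so that sums can be reindexed along bijections and
    exchanged. *)
Lemma double_wiener (G : sgraph) :
  2 * wiener G = \sum_(u : G) \sum_(v : G) dist u v.
Proof.
rewrite pair_big /= (bigID (fun p : G * G => enum_rank p.1 < enum_rank p.2)) /=.
rewrite mul2n -addnn /wiener; congr addn.
rewrite [RHS](bigID (fun p : G * G => enum_rank p.1 == enum_rank p.2)) /=.
rewrite [X in _ = X + _]big1 => [|[u v] /= /andP[_ /eqP/enum_rank_inj->]]; last first.
  by rewrite (@dist_eq _ v [::] 0).
rewrite add0n (reindex_inj (h := fun p : G * G => (p.2, p.1))) /=; last first.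
  by move=> [a b] [a' b'] /= [-> ->].
apply: eq_big => [[u v]|[u v] _] /=; last exact: dist_sym.
by rewrite -leqNgt ltn_neqAle andbC eq_sym.
Qed.

Lemma iso_card (G K : sgraph) : G ~= K -> #|G| = #|K|.
Proof. by case=> f /bij_eq_card. Qed.

Lemma iso_deg (G K : sgraph) (f : G -> K) : bijective f ->
  (forall x y, adj (f x) (f y) = adj x y) -> forall x, deg (f x) = deg x.
Proof.
move=> f_bij fE x; rewrite /deg.
rewrite -(on_card_preimset (f := f)); last exact: onW_bij.
by apply: eq_card => y; rewrite !inE /= fE.
Qed.

Lemma iso_even (G K : sgraph) : G ~= K ->
  #|[pred v : G | ~~ odd (deg v)]| = #|[pred v : K | ~~ odd (deg v)]|.
Proof.
case=> f f_bij fE; rewrite -[RHS](on_card_preimset (f := f)); last exact: onW_bij.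
by apply: eq_card => y; rewrite !inE /= (iso_deg f_bij fE).
Qed.

Lemma iso_dist (G K : sgraph) (f : G -> K) : bijective f ->
  (forall x y, adj (f x) (f y) = adj x y) ->
  forall x y, dist (f x) (f y) = dist x y.
Proof.
move=> f_bij fE x y; rewrite /dist (bij_eq_card f_bij); apply: eq_find => k.
have [g gK fK] := f_bij.
apply/has_walkP/has_walkP => -[p [sp xp lp]].
  exists (map g p); rewrite size_map -[x in path _ x _]gK -[x in last x _]gK.
  rewrite path_map last_map lp gK; split=> //.
  rewrite (eq_path (e' := @adj K)) // => a b /=.
  by rewrite -{2}(fK a) -{2}(fK b) fE.
exists (map f p); rewrite size_map path_map last_map lp; split=> //.
by rewrite (eq_path (e' := @adj G)) // => a b /=; rewrite fE.
Qed.

Lemma iso_wiener (G K : sgraph) : G ~= K -> wiener G = wiener K.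
Proof.
case=> f f_bij fE; apply/eqP; rewrite -(eqn_pmul2l (m := 2)) // !double_wiener.
rewrite (reindex f) /=; last exact: onW_bij.
apply/eqP/eq_bigr => x _; rewrite (reindex f) /=; last exact: onW_bij.
by apply: eq_bigr => y _; rewrite (iso_dist f_bij fE).
Qed.

(** * Orientations of unicyclic graphs *)

(* An orientation of a unicyclic graph: [f] follows the cycle [c] on its
   vertices and sends every other vertex to its parent. *)
Record orientation (G : sgraph) (f : G -> G) (c : seq G) : Prop := Orientation {
  or_adj : forall x y, adj x y = (f x == y) || (f y == x);
  or_size : 2 < size c;
  or_uniq : uniq c;
  or_cycle : fcycle f c;
  or_reach : forall x, exists k, iter k f x \in c }.

(** Truncated subtraction makes [(i - j) + (j - i)] the absolute difference, so this is the distance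
    in the cycle graph of length l. *)
Definition cyc_dist (l i j : nat) : nat :=
  minn ((i - j) + (j - i)) (l - ((i - j) + (j - i))).

Lemma index_next (T : eqType) (p : seq T) x : uniq p -> x \in p ->
  index (next p x) p = (index x p).+1 %% size p.
Proof.
move=> Up px; rewrite next_nth px; move: px; rewrite -index_mem.
case: p Up => // y p Up; rewrite -/(size (y :: p)); set i := index x _ => ltip.
have [ip|pi] := ltnP i (size p).
  by rewrite modn_small // -[nth y p i]/(nth y (y :: p) i.+1) index_uniq.
have -> : i = size p by apply/eqP; rewrite eqn_leq pi andbT -ltnS.
by rewrite nth_default // modnn /= eqxx.
Qed.

Section Orientation.
Variables (G : sgraph) (f : G -> G) (c : seq G) (O : orientation f c).

Definition height (x : G) : nat := ex_minn (or_reach O x).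
Definition croot (x : G) : G := iter (height x) f x.
Definition pos (x : G) : nat := index (croot x) c.
Definition subtree (x : G) : nat := #|[pred u | fconnect f u x]|.

Lemma or_next x : x \in c -> f x = next c x.
Proof. by move=> cx; apply/eqP/(next_cycle (or_cycle O) cx). Qed.

Lemma or_mem_f x : x \in c -> f x \in c.
Proof. by move=> cx; rewrite or_next // mem_next. Qed.

Lemma croot_in x : croot x \in c.
Proof. by rewrite /croot /height; case: ex_minnP. Qed.

Lemma pos_lt x : pos x < size c.
Proof. by rewrite /pos index_mem croot_in. Qed.

Lemma height_c x : x \in c -> height x = 0.
Proof.
by move=> cx; rewrite /height; case: ex_minnP => m _ /(_ 0 cx); case: m.
Qed.

Lemma croot_c x : x \in c -> croot x = x.
Proof. by move=> cx; rewrite /croot height_c. Qed.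

Lemma heightN x : x \notin c -> height x = (height (f x)).+1.
Proof.
rewrite /height => ncx; case: ex_minnP => m cm mmin; case: ex_minnP => k ck kmin.
case: m cm mmin => [|m] cm mmin; first by rewrite /= (negPf ncx) in cm.
apply/eqP; rewrite eqn_leq mmin ?iterSr //= ltnS kmin //.
by rewrite -iterSr.
Qed.

Lemma croot_f x : x \notin c -> croot (f x) = croot x.
Proof. by move=> ncx; rewrite /croot (heightN ncx) iterSr. Qed.

Lemma pos_f x : x \notin c -> pos (f x) = pos x.
Proof. by move=> ncx; rewrite /pos croot_f. Qed.

Lemma or_ind (P : G -> Prop) : (forall x, x \in c -> P x) ->
  (forall x, x \notin c -> P (f x) -> P x) -> forall x, P x.
Proof.
move=> Pc PN x; have [k] := ubnP (height x); elim: k x => // k IHk x.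
have [cx _|ncx] := boolP (x \in c); first exact: Pc.
by rewrite heightN // ltnS => /IHk; apply: PN.
Qed.

Lemma height_f x : height (f x) <= height x.
Proof.
have [cx|ncx] := boolP (x \in c); last by rewrite (heightN ncx).
by rewrite !height_c ?or_mem_f.
Qed.

Lemma fconnect_height u x : fconnect f u x -> height x <= height u.
Proof.
move=> /iter_findex <-; elim: (findex f u x) => //= k IHk.
exact: leq_trans (height_f _) IHk.
Qed.

Lemma fconnect_c u x : fconnect f u x -> u \in c -> x \in c.
Proof.
move=> /iter_findex <- cu; elim: (findex f u x) => //= k IHk.
exact: or_mem_f.
Qed.

Lemma fconnect_fN x : x \notin c -> fconnect f (f x) x = false.
Proof.
by move=> ncx; apply/negP => /fconnect_height; rewrite (heightN ncx) ltnn.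
Qed.

Lemma fconnect_anti u v : u \notin c -> fconnect f u v -> fconnect f v u -> u = v.
Proof.
move=> ncu; rewrite fconnect_eqVf => /orP[/eqP//|fuv vu].
by have := connect_trans fuv vu; rewrite fconnect_fN.
Qed.

Lemma index_f x : x \in c -> index (f x) c = (index x c).+1 %% size c.
Proof. by move=> cx; rewrite or_next // index_next // (or_uniq O). Qed.

Lemma pos_c x : x \in c -> pos x = index x c.
Proof. by move=> cx; rewrite /pos croot_c. Qed.

Lemma pos_next x : x \in c -> pos (f x) = (pos x).+1 %% size c.
Proof. by move=> cx; rewrite !pos_c ?or_mem_f // index_f. Qed.

(** Closed form for the distance. For x off the cycle, the edge from x to [f x] separates the
    subtree of x from the rest, so a shortest path uses it exactly when one of u, v lies below x;
    the other edges run along the cycle between the two roots. *)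
Definition delta (u v : G) : nat :=
  \sum_(x | x \notin c) (fconnect f u x (+) fconnect f v x)
  + cyc_dist (size c) (pos u) (pos v).

Lemma cyc_distC l i j : cyc_dist l i j = cyc_dist l j i.
Proof. by rewrite /cyc_dist addnC. Qed.

Lemma deltaC u v : delta u v = delta v u.
Proof.
by rewrite /delta cyc_distC; congr addn; apply: eq_bigr => x _; rewrite addbC.
Qed.

(** Passing from v to its parent toggles only the term x = v. Truth values are added on both sides
    to avoid a subtraction. *)
Lemma delta_up u v : v \notin c ->
  delta u v + fconnect f u v = delta u (f v) + ~~ fconnect f u v.
Proof.
move=> ncv; rewrite /delta pos_f // (bigD1 v) //= [in RHS](bigD1 v) //=.
rewrite connect0 fconnect_fN // addbT addbF.
rewrite (eq_bigr (fun x => fconnect f u x (+) fconnect f (f v) x : nat)).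
  by case: (fconnect f u v); rewrite /= ?addn0 ?add0n; lia.
move=> x /andP[_ nvx]; rewrite (fconnect_eqVf f v x).
by rewrite eq_sym (negPf nvx).
Qed.

Lemma delta_c u v : v \in c -> delta u v =
  \sum_(x | x \notin c) fconnect f u x + cyc_dist (size c) (pos u) (pos v).
Proof.
move=> cv; congr addn; apply: eq_bigr => x ncx.
rewrite [X in _ (+) X](_ : _ = false) ?addbF //.
by apply/negP => /fconnect_c/(_ cv); rewrite (negPf ncx).
Qed.

Lemma cyc_dist_next l i j : i < l -> j < l ->
  cyc_dist l i j <= (cyc_dist l i (j.+1 %% l)).+1 /\
  cyc_dist l i (j.+1 %% l) <= (cyc_dist l i j).+1.
Proof.
move=> il jl; have [e|ne] := eqVneq j.+1 l.
  by rewrite e modnn /cyc_dist; split; lia.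
by rewrite modn_small /cyc_dist; [split; lia|lia].
Qed.

Lemma delta_f u v :
  delta u v <= (delta u (f v)).+1 /\ delta u (f v) <= (delta u v).+1.
Proof.
have [cv|ncv] := boolP (v \in c); last first.
  by have := delta_up u ncv; case: (fconnect f u v); lia.
rewrite !delta_c ?or_mem_f // (pos_next cv).
by have [] := cyc_dist_next (pos_lt u) (pos_lt v); lia.
Qed.

(** The Lipschitz property makes [delta u] a lower bound for the length of every walk from u;
    [walk_delta] supplies a walk of that length. *)
Lemma delta_lipschitz u v w : adj v w -> delta u w <= (delta u v).+1.
Proof.
by rewrite (or_adj O) => /orP[] /eqP<-; have [] := delta_f u v; have [] := delta_f u w.
Qed.

Lemma delta_id u : delta u u = 0.
Proof. by rewrite /delta big1 => [|x _]; rewrite ?addbb // /cyc_dist; lia. Qed.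

Lemma delta_walk u p : path (@adj G) u p -> delta u (last u p) <= size p.
Proof.
elim/last_ind: p => [|p v IHp]; first by rewrite delta_id.
rewrite rcons_path last_rcons size_rcons => /andP[/IHp le_p pv].
exact: leq_trans (delta_lipschitz u pv) _.
Qed.

Lemma adj_f x : adj x (f x).
Proof. by rewrite (or_adj O) eqxx. Qed.

Definition walk u v k :=
  exists p, [/\ path (@adj G) u p, last u p = v & size p = k].

Lemma walk_sym u v k : walk u v k -> walk v u k.
Proof. by case=> p [up <- <-]; apply: path_rev_adj. Qed.

Lemma walk_cons u v w k : adj u v -> walk v w k -> walk u w k.+1.
Proof. by move=> uv [p [vp lp sp]]; exists (v :: p); rewrite /= uv vp sp. Qed.

Lemma walk_iter u k : walk u (iter k f u) k.
Proof.
elim: k u => [|k IHk] u; first by exists [::].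
by rewrite iterSr; apply: walk_cons (adj_f u) (IHk _).
Qed.

Lemma index_iter x k : x \in c -> index (iter k f x) c = (index x c + k) %% size c.
Proof.
move=> cx; elim: k => [|k IHk] /=; first by rewrite addn0 modn_small ?index_mem.
rewrite index_f ?IHk; last by elim: k {IHk} => //= k; apply: or_mem_f.
by rewrite addnS -[in LHS]addn1 modnDml addn1.
Qed.

Lemma iter_c x k : x \in c -> iter k f x \in c.
Proof. by move=> cx; elim: k => //= k; apply: or_mem_f. Qed.

Lemma index_inj_c x y : x \in c -> y \in c -> index x c = index y c -> x = y.
Proof. by move=> cx cy e; rewrite -(nth_index x cx) e nth_index. Qed.

Lemma walk_c u v : u \in c -> v \in c ->
  walk u v (cyc_dist (size c) (index u c) (index v c)).
Proof.
have walk_to x y k : x \in c -> y \in c ->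
    (index x c + k) %% size c = index y c -> walk x y k.
  move=> cx cy e; have -> : y = iter k f x; last exact: walk_iter.
  by apply: index_inj_c; rewrite ?iter_c // index_iter.
wlog: u v / index u c <= index v c => [hw|uv cu cv].
  have [uv|vu] := leqP (index u c) (index v c); first exact: hw.
  by move=> cu cv; rewrite cyc_distC; apply/walk_sym/hw => //; apply: ltnW.
have ul : index u c < size c by rewrite index_mem.
have vl : index v c < size c by rewrite index_mem.
have [near|far] := leqP (index v c - index u c) (size c - (index v c - index u c)).
  have -> : cyc_dist (size c) (index u c) (index v c) = index v c - index u c.
    by rewrite /cyc_dist; lia.
  by apply: walk_to; rewrite // subnKC // modn_small.
have -> : cyc_dist (size c) (index u c) (index v c)
        = size c - (index v c - index u c) by rewrite /cyc_dist; lia.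
apply/walk_sym/walk_to => //.
have -> : index v c + (size c - (index v c - index u c)) = index u c + size c by lia.
by rewrite modnDr modn_small.
Qed.

(** Induction on the heights: a v off the cycle with u not below it is replaced by [f v], which
    lowers [delta] by one. If neither end can be lifted, both are on the cycle, or each is below the
    other and they coincide; one end alone on the cycle is impossible because [f] never leaves the
    cycle. *)
Lemma walk_delta u v : walk u v (delta u v).
Proof.
have [k] := ubnP (height u + height v).
elim: k u v => // k IHk u v; rewrite ltnS => le_k.
wlog: u v le_k / (v \notin c) && ~~ fconnect f u v => [hw|].
  have [Huv|Nuv] := boolP ((v \notin c) && ~~ fconnect f u v); first exact: hw.
  have [Hvu|Nvu] := boolP ((u \notin c) && ~~ fconnect f v u).
    by rewrite deltaC; apply/walk_sym/hw => //; rewrite addnC.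
  move: Nuv Nvu; rewrite !negb_and !negbK.
  case cv: (v \in c) => /=; case cu: (u \in c) => //=.
  - move=> _ _; rewrite delta_c // big1 => [|x ncx].
      by rewrite !pos_c //; apply: walk_c.
    by apply/eqP; rewrite eqb0; apply/negP => /fconnect_c/(_ cu); rewrite (negPf ncx).
  - by move=> _ /fconnect_c/(_ cv); rewrite cu.
  - by move=> /fconnect_c/(_ cu); rewrite cv.
  move=> uv vu; rewrite -(fconnect_anti (negbT cu) uv vu) delta_id.
  by exists [::].
case/andP=> ncv nuv; have := delta_up u ncv.
rewrite (negPf nuv) addn0 addn1 => ->.
apply/walk_sym/(walk_cons (adj_f v))/walk_sym/IHk.
by apply: leq_trans le_k; rewrite (heightN ncv) addnS.
Qed.

Lemma dist_delta u v : dist u v = delta u v.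
Proof.
have [q [uq lq sq]] := walk_delta u v; rewrite -{1}lq.
apply: dist_eq; rewrite ?sq // => p up lp.
by rewrite -lq -lp; apply: delta_walk.
Qed.

(** After exchanging the sums, each x off the cycle counts the ordered pairs separated by its edge
    to [f x]. *)
Lemma double_wiener_split : 2 * wiener G =
  2 * \sum_(x | x \notin c) subtree x * (#|G| - subtree x)
  + \sum_(u : G) \sum_(v : G) cyc_dist (size c) (pos u) (pos v).
Proof.
rewrite double_wiener.
under eq_bigr => u _ do (under eq_bigr => v _ do rewrite dist_delta; rewrite big_split /=).
rewrite big_split /=; congr addn.
rewrite -[LHS](eq_bigr _ (fun u _ => exchange_big _ _ _ _ _ _)) exchange_big /=.
rewrite big_distrr /=; apply: eq_bigr => x _.
have cardN : #|[pred u | ~~ fconnect f u x]| = #|G| - subtree x.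
  by rewrite /subtree -(cardC [pred u | fconnect f u x]) addKn; apply: eq_card.
rewrite exchange_big /=.
rewrite (bigID (fun u => fconnect f u x)) /=.
rewrite (eq_bigr (fun=> #|G| - subtree x)) => [|u ux]; last first.
  rewrite -cardN -sum1_card [RHS]big_mkcond; apply: eq_bigr => v _.
  by rewrite ux inE; case: (connect _ _ _).
rewrite [X in _ + X](eq_bigr (fun=> subtree x)) => [|u ux]; last first.
  rewrite /subtree -sum1_card [RHS]big_mkcond; apply: eq_bigr => v _.
  by rewrite (negPf ux) inE; case: (connect _ _ _).
by rewrite !sum_nat_const cardN -/(subtree x) mul2n -addnn [X in _ + X = _]mulnC.
Qed.

End Orientation.

Lemma next_last (T : eqType) (y : T) p : uniq (y :: p) ->
  next (y :: p) (last y p) = y.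
Proof.
move=> Up; rewrite next_nth mem_last index_last //.
by rewrite nth_default.
Qed.

(* An edge outside the orientation would close a second cycle with a path that
   avoids it. *)
Lemma unicyclic_orientation (G : sgraph) : unicyclic G ->
  exists f : G -> G, exists c : seq G, orientation f c.
Proof.
case=> conn [E [[c c_cyc ->] Euniq]]; have /andP[c_size /andP[c_adj c_uniq]] := c_cyc.
have [c0 c0c] : exists x, x \in c.
  by case: (c) c_size => // x p _; exists x; rewrite mem_head.
(* [h] will be the distance to the cycle; off the cycle, [f] picks a neighbour that is closer, and
   on it the successor in [c]. *)
pose P x k := [exists v, (v \in c) && has_walk x v k].
have exP x : exists k, P x k.
  have /connectP[p xp lp] := conn x c0; exists (size p); apply/existsP; exists c0.
  by rewrite c0c; apply/has_walkP; exists p.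
pose h x := ex_minn (exP x).
have exf x : exists y, if x \in c then y == next c x else adj x y && (h y < h x).
  have [cx|ncx] := boolP (x \in c); first by exists (next c x).
  rewrite /h; case: ex_minnP => k /existsP[v /andP[cv /has_walkP[p [sp xp lp]]]] _.
  case: p sp xp lp => [|y p] sp /= xp lp; first by rewrite lp cv in ncx.
  case/andP: xp => xy yp; exists y; rewrite xy; case: ex_minnP => m _ /(_ (size p)).
  move=> mle; rewrite -sp /= ltnS mle //; apply/existsP; exists v; rewrite cv.
  by apply/has_walkP; exists p.
have [f fP] := fin_all_exists exf.
have fc x : x \in c -> f x = next c x by move=> cx; have := fP x; rewrite cx => /eqP.
have fN x : x \notin c -> adj x (f x) /\ h (f x) < h x.
  by move=> ncx; have := fP x; rewrite (negPf ncx) => /andP[].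
have adjf x : adj x (f x).
  have [cx|ncx] := boolP (x \in c); last by have [] := fN x ncx.
  by rewrite fc //; apply: next_cycle.
have reach x : exists k, iter k f x \in c.
  have [k] := ubnP (h x); elim: k x => // k IHk x lek.
  have [cx|ncx] := boolP (x \in c); first by exists 0.
  have [_ hx] := fN x ncx; have [m cm] := IHk (f x) (leq_trans hx lek).
  by exists m.+1; rewrite iterSr.
have fcyc : fcycle f c.
  by apply: cycle_from_next => // x cx; rewrite /= fc.
exists f, c; split=> // x y; apply/idP/idP; last first.
  by case/orP => /eqP<-; rewrite // adj_sym.
move=> xy; apply: contraT; rewrite negb_or => /andP[nfx nfy].
pose e := [rel u v | adj u v && ([set u; v] != [set x; y])].
have ef u : e u (f u).
  rewrite /= adjf; apply/negP => /eqP/setP euv.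
  have := euv x; have := euv y; rewrite !inE !eqxx orbT /=.
  have nxy : x != y by apply: contraTneq xy => ->; rewrite adj_irrefl.
  case/orP => /eqP ?; case/orP => /eqP ?; subst.
  - by rewrite eqxx in nxy.
  - by rewrite eqxx in nfy.
  - by rewrite eqxx in nfx.
  - by rewrite eqxx in nxy.
have esym : connect_sym e.
  by apply: sym_connect_sym => u v /=; rewrite adj_sym setUC.
have subc u v : fconnect f u v -> connect e u v.
  by apply: connect_sub => a b /eqP<-; apply/connect1/ef.
have toc0 u : connect e u c0.
  have [k ck] := reach u; apply: connect_trans (subc _ _ (fconnect_iter f k u)) _.
  apply: subc; rewrite (fconnect_cycle fcyc) //.
have: connect e y x by apply: connect_trans (toc0 y) _; rewrite esym.
case/connectP => p0 yp0 lp0; move: lp0; case/shortenP: yp0 => p yp Up _ lp.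
have yadj : path (@adj G) y p by apply: sub_path yp => a b /andP[].
have pcyc : is_cycle (y :: p).
  rewrite /is_cycle /ucycleb Up andbT /= rcons_path yadj -lp xy andbT.
  case: p lp yp {Up yadj} => [|a [|b p]] //= lp.
    by rewrite lp adj_irrefl in xy.
  by rewrite lp setUC eqxx andbF.
have: cycle_edges c = cycle_edges (y :: p) by apply: Euniq; exists (y :: p).
(* The new cycle contains the edge xy, while every edge of [c] joins some z to [f z] and so differs
   from xy by [ef]. *)
move/setP/(_ [set x; y]).
have -> : ([set x; y] \in cycle_edges (y :: p)) = true.
  apply/imsetP; exists x; first by rewrite lp mem_last.
  by rewrite [X in next _ X]lp next_last.
case/imsetP => z cz; have := ef z; rewrite /= fc // => /andP[_ /eqP].
by move=> neq eq; case: neq.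
Qed.

Section OrientationUnicyclic.
Variables (G : sgraph) (f : G -> G) (c : seq G) (O : orientation f c).

Lemma orientation_connected : connected G.
Proof. by move=> u v; have [p [up <- _]] := walk_delta O u v; apply/connectP; exists p. Qed.

(** A periodic vertex is reached from its own image, which [fconnect_fN] forbids off the cycle. *)
Lemma periodic_c x k : 0 < k -> iter k f x = x -> x \in c.
Proof.
move=> k0 kx; apply: contraT => ncx.
have := fconnect_fN O ncx.
by rewrite -{2}kx -(prednK k0) iterSr fconnect_iter.
Qed.

Lemma orientation_is_cycle : is_cycle c.
Proof.
rewrite /is_cycle (or_size O) /ucycleb (or_uniq O) andbT.
by apply: sub_cycle (or_cycle O) => x y /eqP<-; apply: adj_f O x.
Qed.

(** This keeps the two cycle neighbours of a vertex distinct and excludes 2-periodic points of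
    [f]. *)
Lemma modn_add2_neq i l : i < l -> 2 < l -> (i.+1 %% l).+1 %% l != i.
Proof.
move=> il l3; rewrite -addn1 -[i.+1]addn1 modnDml -addnA.
have [lt|ge] := ltnP (i + 2) l; first by rewrite modn_small //; lia.
have -> : i + (1 + 1) = l + (i + 2 - l) by lia.
by rewrite modnDl modn_small; lia.
Qed.

(* Consecutive arcs of a simple cycle agree, since [f] is single-valued: the
   cycle is followed either forwards everywhere or backwards everywhere. *)
Lemma cycle_forward_or_backward q : is_cycle q ->
  {in q, forall x, f x = next q x} \/ {in q, forall x, f (next q x) = x}.
Proof.
case/andP=> q3 /andP[q_adj Uq].
have arc x : x \in q -> (f x == next q x) || (f (next q x) == x).
  by move=> qx; rewrite -(or_adj O); apply: next_cycle.
have next2 x : x \in q -> next q (next q x) != x.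
  move=> qx; have := index_next Uq (etrans (mem_next q x) qx).
  rewrite (index_next Uq qx); case: eqP => // -> /eqP.
  by rewrite eq_sym (negPf (modn_add2_neq _ _)) // index_mem.
have [/allP fwd|/allPn[x0 qx0 nf0]] := boolP (all (fun x => f x == next q x) q).
  by left=> x /fwd/eqP.
right=> x qx; suff nfx : f x != next q x.
  by have := arc x qx; rewrite (negPf nfx) => /eqP.
move: qx; rewrite -(fconnect_cycle (cycle_next Uq) qx0) => /iter_findex <-.
elim: (findex _ _ _) => //= k; set y := iter k _ _ => nfy.
have qy : y \in q by rewrite /y; elim: (k) => //= j; rewrite mem_next.
have := arc y qy; rewrite (negPf nfy) => /eqP ->.
by rewrite eq_sym next2.
Qed.

(** Read in the right direction, any cycle of [G] is a cycle of [f]; its vertices are periodic,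
    hence on [c], and the orbit of one of them exhausts [c]. *)
Lemma cycle_edges_orientation q : is_cycle q ->
  cycle_edges q = [set [set x; f x] | x in c].
Proof.
move=> q_cyc; have /andP[q3 /andP[_ Uq]] := q_cyc.
have q_c q' : uniq q' -> fcycle f q' -> q' =i q -> q =i c.
  move=> Uq' q'_cyc q'q x; rewrite -q'q.
  have sub y : y \in q' -> y \in c.
    move=> qy; apply: contraT => /(fconnect_fN O).
    by rewrite (fconnect_cycle q'_cyc) ?qy // (eqP (next_cycle q'_cyc qy)) mem_next.
  apply/idP/idP => [/sub//|cx].
  have [y qy] : exists y, y \in q'.
    by case: (q) q3 q'q => // y p _ /(_ y); rewrite mem_head; exists y.
  by rewrite -(fconnect_cycle q'_cyc qy) (fconnect_cycle (or_cycle O) (sub y qy)).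
case: (cycle_forward_or_backward q_cyc) => [fwd|bwd].
  have qc : q =i c.
    by apply: (q_c q) => //; apply: cycle_from_next => // x qx; rewrite /= fwd.
  apply/setP => A; apply/imsetP/imsetP => -[x qx ->]; exists x.
  - by rewrite -qc.
  - by rewrite fwd.
  - by rewrite qc.
  - by rewrite -fwd ?qc.
have fprev x : x \in q -> f x = prev q x.
  by move=> qx; rewrite -{1}[x](next_prev Uq) bwd ?mem_prev.
have qc : q =i c.
  have Urq : uniq (rev q) by rewrite rev_uniq.
  apply: (q_c (rev q)) => // [|x]; last by rewrite mem_rev.
  apply: cycle_from_next => // x.
  by rewrite mem_rev next_rev // => qx /=; rewrite fprev.
apply/setP => A; apply/imsetP/imsetP => -[x qx ->].
  by exists (next q x); rewrite ?bwd -?qc ?mem_next // setUC.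
by exists (prev q x); rewrite ?mem_prev ?next_prev ?qc // -fprev ?qc // setUC.
Qed.

Lemma orientation_unicyclic : unicyclic G.
Proof.
split; first exact: orientation_connected.
exists (cycle_edges c); split; first by exists c => //; apply: orientation_is_cycle.
by move=> _ [q qc ->]; rewrite !cycle_edges_orientation ?orientation_is_cycle.
Qed.

End OrientationUnicyclic.

(** * Subtree sizes, cycle weights and the Wiener index *)

Lemma odd_sum (T : finType) (F : T -> nat) :
  odd (\sum_(i : T) F i) = odd #|[pred i | odd (F i)]|.
Proof.
rewrite -sum1_card [in RHS]big_mkcond /= !(big_morph odd oddD (erefl _)).
by apply: eq_bigr => i _; rewrite inE; case: (odd (F i)).
Qed.

(** The transmission of a vertex in the cycle graph of length l. *)
Definition cyc_sum l := \sum_(j < l) cyc_dist l 0 j.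

Lemma cyc_sum_at l i : i < l -> \sum_(j < l) cyc_dist l i j = cyc_sum l.
Proof.
move=> il; rewrite /cyc_sum -!(big_mkord xpredT).
rewrite (big_cat_nat _ (n := i)) ?(ltnW il) //=.
rewrite [RHS](big_cat_nat _ (n := l - i)) ?leq_subr //= addnC; congr addn.
  rewrite -{1}[i]add0n big_addn [RHS]big_nat [LHS]big_nat.
  by apply: eq_bigr => j jl; rewrite /cyc_dist; lia.
rewrite -{1}[l - i]add0n big_addn subKn ?(ltnW il) // [RHS]big_nat [LHS]big_nat.
by apply: eq_bigr => j jl; rewrite /cyc_dist; lia.
Qed.

(** Position j + 1 on the longer cycle is one farther from 0 than position j on the shorter one; the
    last position contributes 1. *)
Lemma cyc_sumSS l : cyc_sum l.+2 = cyc_sum l + l.+1.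
Proof.
rewrite /cyc_sum big_ord_recl /= big_ord_recr /=.
rewrite (eq_bigr (fun j : 'I_l => cyc_dist l 0 j + 1)) => [|j _]; last first.
  by have := ltn_ord j; rewrite /cyc_dist /bump /=; lia.
by rewrite big_split /= sum1_card card_ord /cyc_dist /bump; lia.
Qed.

Lemma cyc_sumE l : 4 * cyc_sum l + odd l = l * l.
Proof.
suff [] : 4 * cyc_sum l + odd l = l * l /\ 4 * cyc_sum l.+1 + odd l.+1 = l.+1 * l.+1 by [].
elim: l => [|l [IH0 IH1]]; last first.
  by split=> //; rewrite cyc_sumSS /= negbK; move: IH0 IH1; case: (odd l); lia.
by rewrite /cyc_sum big_ord0 big_ord1.
Qed.

(** All rows of the distance matrix of a cycle have the same sum, so the constant and linear terms
    of the expanded product are explicit. The quadratic remainder vanishes when only one [t i] is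
    nonzero. *)
Lemma weighted_cyc_sum l (t : nat -> nat) :
  \sum_(i < l) \sum_(j < l) (t i).+1 * (t j).+1 * cyc_dist l i j =
  (l + 2 * \sum_(i < l) t i) * cyc_sum l
  + \sum_(i < l) \sum_(j < l) t i * t j * cyc_dist l i j.
Proof.
under eq_bigr => i _.
  under eq_bigr => j _.
    have -> : (t i).+1 * (t j).+1 * cyc_dist l i j =
      cyc_dist l i j + t i * cyc_dist l i j + t j * cyc_dist l i j
      + t i * t j * cyc_dist l i j by lia.
    over.
  rewrite !big_split /= -big_distrr /= cyc_sum_at //.
  over.
rewrite !big_split /= -big_distrl /= [X in _ + X + _ = _]exchange_big /=.
rewrite [X in _ + X + _ = _](eq_bigr (fun j : 'I_l => t j * cyc_sum l)) => [|j _].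
  by rewrite -big_distrl /= big_const_ord iter_addn_0; lia.
by rewrite -big_distrr /= (eq_bigr _ (fun i _ => cyc_distC _ _ _)) cyc_sum_at.
Qed.

Section Counting.
Variables (G : sgraph) (f : G -> G) (c : seq G) (O : orientation f c).
Local Notation n := #|G|.
Local Notation l := (size c).
Local Notation s := (subtree f).
Local Notation pos := (pos O).

Lemma ff_neq x : f (f x) != x.
Proof.
apply/negP => /eqP ffx; have cx := periodic_c O (k := 2) isT ffx.
have := index_f O (or_mem_f O cx); rewrite ffx (index_f O cx) => /eqP.
by rewrite eq_sym (negPf (modn_add2_neq _ _)) ?index_mem // (or_size O).
Qed.

(** By [ff_neq] the neighbour [f v] is not itself a child of v. On the cycle, the predecessor counts
    as a child. *)
Lemma deg_children v : deg v = (#|[pred u | f u == v]|).+1.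
Proof.
rewrite /deg -(cardID (pred1 (f v))) /= addnC -addn1; congr addn.
  apply: eq_card => u; rewrite !inE (or_adj O) [f v == u]eq_sym.
  case: (u =P f v) => [->|_]; last by [].
  by rewrite (negPf (ff_neq v)).
rewrite -(card1 (f v)); apply: eq_card => u; rewrite !inE (or_adj O) eq_sym.
by case: (u =P f v) => [->|]; rewrite ?eqxx ?andbF ?andbT.
Qed.

Lemma sum_deg : \sum_(v : G) deg v = 2 * n.
Proof.
under eq_bigr => v _ do rewrite deg_children -add1n -sum1_card.
rewrite big_split /= sum1_card mul2n -addnn; congr addn.
by rewrite -[RHS]sum1_card [RHS](partition_big f xpredT).
Qed.

Definition n_odd := #|[pred v : G | odd (deg v)]|.
Definition n_even := #|[pred v : G | ~~ odd (deg v)]|.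

Lemma n_oddD : n_odd + n_even = n.
Proof. by rewrite /n_odd -(cardC [pred v : G | odd (deg v)]). Qed.

Lemma even_n_odd : ~~ odd n_odd.
Proof. by rewrite -odd_sum sum_deg oddM. Qed.

Definition n_leaf := #|[pred x | (x \notin c) && (s x == 1)]|.

Lemma card_c : #|c| = l.
Proof. exact/card_uniqP/(or_uniq O). Qed.

Lemma card_notin_c : #|[pred x | x \notin c]| = n - l.
Proof. by rewrite -card_c -(cardC (mem c)) addKn; apply: eq_card. Qed.

Lemma size_c_le : l <= n.
Proof. by rewrite -card_c max_card. Qed.

Lemma subtree_gt0 x : 0 < s x.
Proof. by apply/card_gt0P; exists x; rewrite inE connect0. Qed.

Lemma subtree_c x : x \notin c -> s x + l <= n.
Proof.
move=> ncx; have := card_notin_c; have := size_c_le.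
have : s x <= #|[pred x | x \notin c]|; last by lia.
apply/subset_leq_card/subsetP => u; rewrite !inE => ux.
by apply: contra ncx; apply: (fconnect_c O).
Qed.

Lemma leaf_no_child x u : s x = 1 -> f u = x -> u = x.
Proof.
move=> /eqP sx fu; apply/eqP; apply: contraTT sx => nux; rewrite neq_ltn.
apply/orP; right; rewrite /subtree (cardD1 x) inE connect0 (cardD1 u) !inE nux.
by rewrite -fu fconnect1.
Qed.

Lemma leaf_deg x : x \notin c -> s x = 1 -> deg x = 1.
Proof.
move=> ncx sx; rewrite deg_children; congr S; apply: eq_card0 => u; rewrite !inE.
apply/negP => /eqP fu; have ux := leaf_no_child sx fu.
by have := fconnect_fN O ncx; rewrite -{1}ux fu connect0.
Qed.

Lemma subtree_child x : x \notin c -> s x != 1 -> exists2 u, f u = x & u \notin c.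
Proof.
move=> ncx sx; have := subtree_gt0 x; rewrite /subtree => s0.
have /card_gt1P[u [v [xu xv uv]]] : 1 < #|[pred u | fconnect f u x]|.
  by rewrite ltn_neqAle eq_sym sx.
wlog ux : u v xu xv uv / u != x => [hw|].
  have [eux|] := eqVneq u x; last exact: hw xv uv.
  by apply: (hw v u) => //; rewrite eq_sym // -eux.
move: xu; rewrite inE => /iter_findex; case: findex => [/= e|k /= e].
  by rewrite e eqxx in ux.
exists (iter k f u) => //; apply: contra ncx => ck; rewrite -e; exact: or_mem_f O _ ck.
Qed.

Lemma subtree2_deg x : x \notin c -> s x = 2 -> deg x = 2.
Proof.
move=> ncx sx; rewrite deg_children; congr S.
have [|u fu ncu] := subtree_child ncx; first by rewrite sx.
apply/eqP; rewrite eqn_leq; apply/andP; split; last first.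
  by apply/card_gt0P; exists u; rewrite inE fu.
have: s x <= 2 by rewrite sx.
rewrite /subtree (cardD1 x) inE connect0 add1n ltnS; apply: leq_trans.
apply/subset_leq_card/subsetP => v; rewrite !inE => /eqP fv.
rewrite -[X in connect _ _ X]fv fconnect1 andbT.
by apply/negP => /eqP vx; have := fconnect_fN O ncx; rewrite -{1}vx fv connect0.
Qed.

Lemma n_leaf_odd : n_leaf <= n_odd.
Proof.
apply/subset_leq_card/subsetP => x; rewrite !inE => /andP[ncx /eqP sx].
by rewrite leaf_deg.
Qed.

Lemma n_leaf_c : n_leaf + l <= n.
Proof.
have := card_notin_c; have : n_leaf <= #|[pred x | x \notin c]|; last first.
  by have := size_c_le; lia.
by apply/subset_leq_card/subsetP => x; rewrite !inE => /andP[].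
Qed.

Definition tree_part := \sum_(x | x \notin c) s x * (n - s x).
Definition cyc_part := \sum_(u : G) \sum_(v : G) cyc_dist l (pos u) (pos v).

Lemma double_wienerE : 2 * wiener G = 2 * tree_part + cyc_part.
Proof. exact: double_wiener_split. Qed.

(** The equality case of [tree_part_ge]: every tree is a subdivided star with branches of length at
    most 2. *)
Definition short := [forall x, (x \notin c) ==> (s x <= 2)].

Let min_part := \sum_(x | x \notin c) if s x == 1 then n - 1 else 2 * (n - 2).

Let min_partE : min_part = n_leaf * (n - 1) + (n - l - n_leaf) * (2 * (n - 2)).
Proof.
rewrite /min_part (bigID (fun x => s x == 1)) /=; congr addn.
  rewrite (eq_bigr (fun=> n - 1)); first by rewrite sum_nat_const.
  by move=> x /andP[_ ->].
rewrite (eq_bigr (fun=> 2 * (n - 2))); last by move=> x /andP[_ /negPf->].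
rewrite sum_nat_const; congr muln; rewrite -card_notin_c /n_leaf.
rewrite -(cardID (fun x => s x == 1) [pred x | x \notin c]).
rewrite [X in _ = X + _ - _](_ : _ = n_leaf); last by apply: eq_card => x; rewrite !inE andbC.
by rewrite addKn; apply: eq_card => x; rewrite !inE andbC.
Qed.

Lemma tree_part_short : short ->
  tree_part = n_leaf * (n - 1) + (n - l - n_leaf) * (2 * (n - 2)).
Proof.
move=> /forallP sh; rewrite -min_partE; apply: eq_bigr => x ncx.
have := sh x; rewrite ncx /=; have := subtree_gt0 x.
by case: (s x) => [|[|[|]]] //=; rewrite ?mul1n.
Qed.

Lemma tree_part_ge :
  n_leaf * (n - 1) + (n - l - n_leaf) * (2 * (n - 2)) + ~~ short <= tree_part.
Proof.
(* If [s x > 2], then 3 <= s x <= n - 3 by [subtree_c] and l >= 3. As s(n - s) is concave in s, it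
   is at least 3(n - 3), which exceeds 2(n - 2) because n >= 6. *)
have term x : x \notin c ->
  (if s x == 1 then n - 1 else 2 * (n - 2)) + (2 < s x) <= s x * (n - s x).
  move=> ncx; have := subtree_gt0 x; have := subtree_c ncx; have := or_size O.
  case: eqP => [->|]; first lia.
  by case: ltnP; nia.
rewrite -min_partE; have [sh|nsh] := boolP short.
  rewrite addn0; apply: leq_sum => x ncx; apply: leq_trans (term x ncx).
  exact: leq_addr.
have [x ncx sx] : exists2 x, x \notin c & 2 < s x.
  move: nsh; rewrite negb_forall => /existsP[x]; rewrite negb_imply -ltnNge.
  by case/andP; exists x.
rewrite /min_part /tree_part (bigD1 x) //= [X in _ <= X](bigD1 x) //=.
rewrite addnAC; apply: leq_add; first by have := term x ncx; rewrite sx.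
apply: leq_sum => y /andP[ncy _]; apply: leq_trans (term y ncy); exact: leq_addr.
Qed.

Definition weight i := #|[pred u | pos u == i]|.

Lemma cyc_part_weight :
  cyc_part = \sum_(i < l) \sum_(j < l) weight i * weight j * cyc_dist l i j.
Proof.
pose p u := Ordinal (pos_lt O u).
have wE (i : 'I_l) : #|[pred u | p u == i]| = weight i by apply: eq_card.
rewrite /cyc_part (partition_big p xpredT) //=; apply: eq_bigr => i _.
rewrite (eq_bigr (fun=> \sum_(j < l) weight j * cyc_dist l i j)) => [|u /eqP pu].
  by rewrite sum_nat_const wE big_distrr /=; apply: eq_bigr => j _; rewrite mulnA.
rewrite (partition_big p xpredT) //=; apply: eq_bigr => j _.
rewrite (eq_bigr (fun=> cyc_dist l i j)) => [|v /eqP pv].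
  by rewrite sum_nat_const wE.
by rewrite -pu -pv.
Qed.

Lemma sum_weight : \sum_(i < l) weight i = n.
Proof.
pose p u := Ordinal (pos_lt O u).
rewrite -[RHS]sum1_card (partition_big p xpredT) //=; apply: eq_bigr => i _.
by rewrite sum1_card; apply: eq_card.
Qed.

Lemma pos_nth x0 i : i < l -> pos (nth x0 c i) = i.
Proof. by move=> il; rewrite pos_c ?mem_nth // index_uniq // (or_uniq O). Qed.

Lemma c_inhab : G.
Proof. by have := or_size O; case: (c) => // x. Qed.

Lemma weight_gt0 i : i < l -> 0 < weight i.
Proof.
move=> il; apply/card_gt0P; exists (nth c_inhab c i).
by rewrite inE pos_nth.
Qed.

Definition extra i := (weight i).-1.

Lemma weightE i : i < l -> weight i = (extra i).+1.
Proof. by move=> il; rewrite prednK // weight_gt0. Qed.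

Lemma sum_extra : l + \sum_(i < l) extra i = n.
Proof.
rewrite -sum_weight -[l in l + _]card_ord -sum1_card -big_split /=.
by apply: eq_bigr => i _; rewrite weightE.
Qed.

(** The coefficient is l + 2(n - l), as the extras add up to n - l; the double sum is the penalty
    for several nontrivial trees. *)
Lemma cyc_partE : cyc_part = (2 * n - l) * cyc_sum l
  + \sum_(i < l) \sum_(j < l) extra i * extra j * cyc_dist l i j.
Proof.
rewrite cyc_part_weight -[RHS]/(_ + _).
under eq_bigr => i _ do under eq_bigr => j _ do rewrite !weightE //.
rewrite weighted_cyc_sum; congr (_ * _ + _).
by have := sum_extra; lia.
Qed.

(** [weighted_cyc_sum] applies a second time, to the extras, all of which are positive; the
    coefficients 2n - l and 2n - 3l add up to 4(n - l). *)
Lemma cyc_part_ge2 : (forall i, i < l -> 1 < weight i) ->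
  4 * (n - l) * cyc_sum l <= cyc_part.
Proof.
move=> w2; rewrite cyc_partE.
under eq_bigr => i _.
  under eq_bigr => j _.
    have -> : extra i = (extra i).-1.+1 by have := w2 i (ltn_ord i); rewrite /extra; lia.
    have -> : extra j = (extra j).-1.+1 by have := w2 j (ltn_ord j); rewrite /extra; lia.
    over.
  over.
rewrite (weighted_cyc_sum _ (fun i => (extra i).-1)) addnA -mulnDl.
apply: leq_trans (leq_addr _ _); apply: leq_mul => //.
have := sum_extra.
have -> : \sum_(i < l) extra i = \sum_(i < l) (extra i).-1 + l.
  rewrite -[l in _ + l]card_ord -sum1_card -big_split /=.
  by apply: eq_bigr => i _; have := w2 i (ltn_ord i); rewrite /extra; lia.
have := or_size O; lia.
Qed.

Lemma weight2_n : (forall i, i < l -> 1 < weight i) -> 2 * l <= n.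
Proof.
move=> w2; have -> : 2 * l = \sum_(i < l) 2 by rewrite big_const_ord iter_addn_0.
by rewrite -sum_weight; apply: leq_sum => i _; apply: w2.
Qed.

Lemma deg_c v : v \in c -> deg v = (#|[pred u | (u \notin c) && (f u == v)]|).+2.
Proof.
move=> cv; rewrite deg_children -(cardID (mem c)) -[RHS]addn1 -addn1; congr (_ + _).
rewrite -add1n; congr (_ + _).
  rewrite -(card1 (prev c v)); apply: eq_card => u; rewrite !inE.
  apply/andP/eqP => [[/eqP fu cu]|->].
    by rewrite -fu (or_next O cu) prev_next // (or_uniq O).
  by rewrite mem_prev cv (or_next O) ?mem_prev // next_prev // (or_uniq O).
Qed.

Lemma weight1_deg v : v \in c -> weight (pos v) = 1 -> deg v = 2.
Proof.
move=> cv /eqP w1; rewrite deg_c //; congr _.+2; apply: eq_card0 => u; rewrite !inE.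
apply/negP => /andP[ncu /eqP fu]; move: w1; rewrite /weight (cardD1 v) inE eqxx.
rewrite (cardD1 u) !inE -fu (pos_f O) // fu eqxx.
by case: (u =P v) => // euv; rewrite euv cv in ncu.
Qed.

(** A cycle vertex with a trivial tree has degree 2, so each trivial tree uses up one even
    vertex. *)
Lemma weight1_even : #|[pred i : 'I_l | weight i == 1]| <= n_even.
Proof.
pose g (i : 'I_l) := nth c_inhab c i.
rewrite -(card_in_image (f := g)) => [|i j _ _ /eqP].
  apply/subset_leq_card/subsetP => _ /imageP[i wi ->]; rewrite inE weight1_deg //.
    by rewrite mem_nth.
  by rewrite pos_nth //; apply/eqP.
by rewrite nth_uniq ?(or_uniq O) // => /eqP/val_inj.
Qed.

Lemma deg_c_leaves v : v \in c -> (forall x, x \notin c -> s x = 1) ->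
  deg v = (weight (pos v)).+1.
Proof.
move=> cv s1; rewrite deg_c // /weight [in RHS](cardD1 v) inE eqxx add1n; congr _.+2.
apply: eq_card => u; rewrite !inE; case cu: (u \in c) => /=.
  apply/esym/andP => -[nuv /eqP]; rewrite !pos_c // => /(index_inj_c cu cv) euv.
  by rewrite euv eqxx in nuv.
have -> : u != v by apply: contraFneq cu => ->.
apply/eqP/eqP => [<-|puv]; first by rewrite pos_f ?cu.
have cfu : f u \in c.
  apply: contraT => ncfu; have := leaf_no_child (s1 _ ncfu) (erefl _).
  move=> e; have := fconnect_fN O (negbT cu); rewrite -e connect0 //.
apply: (index_inj_c cfu cv); rewrite -!(pos_c O) //.
by rewrite pos_f ?cu.
Qed.

Lemma card_weight1 : #|[pred i : 'I_l | weight i == 1]| = \sum_(i < l) (weight i == 1).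
Proof.
by rewrite -sum1_card big_mkcond; apply: eq_bigr => i _; rewrite inE; case: eqP.
Qed.

Lemma weight1_le : \sum_(i < l) (weight i == 1) <= n_even.
Proof. by rewrite -card_weight1 weight1_even. Qed.

Lemma weight_ge2 : n_even = 0 -> forall i, i < l -> 1 < weight i.
Proof.
move=> r0 i il; have := weight1_le; rewrite r0 leqn0 sum_nat_eq0 => /forallP.
by move=> /(_ (Ordinal il)) /=; have := weight_gt0 il; lia.
Qed.

Lemma sum_weight3 : l = 3 -> weight 0 + weight 1 + weight 2 = n.
Proof.
move=> l3; rewrite -(sum_weight) l3 !big_ord_recl big_ord0 /= /bump /=.
by rewrite !add1n addn0 addnA.
Qed.

Lemma sum_weight1_3 : l = 3 -> (weight 0 == 1) + (weight 1 == 1) + (weight 2 == 1) <= n_even.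
Proof.
move=> l3; have := weight1_le; rewrite l3 !big_ord_recl big_ord0 /= /bump /=.
by rewrite !add1n addn0 addnA.
Qed.

End Counting.

(** * Reassembling a graph from its trees *)

Lemma iso_sym (G K : sgraph) : G ~= K -> K ~= G.
Proof.
case=> f [g fK gK] fE; exists g; first by exists f.
by move=> x y; rewrite -fE !gK.
Qed.

Section Glue.
Variables (G : sgraph) (f : G -> G) (c : seq G) (O : orientation f c).
Local Notation l := (size c).
Local Notation s := (subtree f).
Local Notation pos := (pos O).
Local Notation weight := (weight O).

(** The trees of [G] are not graphs of their own, so T is compared with the fibre of [pos] over i
    through an embedding with exactly that image. *)
Definition tree_at (i : nat) (T : rooted_graph) : Prop :=
  exists g : T -> G,
    [/\ injective g, g (rg_root T) \in c, forall x, pos (g x) = i,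
        forall u, pos u = i -> exists x, g x = u
      & forall x y, adj (g x) (g y) = adj x y].

Lemma pos_inj_c u v : u \in c -> v \in c -> pos u = pos v -> u = v.
Proof. by move=> cu cv; rewrite !pos_c // => /(index_inj_c cu cv). Qed.

Lemma adj_pos_neq a b : pos a != pos b ->
  adj a b = [&& a \in c, b \in c
    & ((pos a).+1 %% l == pos b) || ((pos b).+1 %% l == pos a)].
Proof.
move=> nab; rewrite (or_adj O).
have step x y : pos x != pos y -> (f x == y) = [&& x \in c, y \in c & (pos x).+1 %% l == pos y].
  move=> nxy; apply/eqP/and3P => [fxy|[cx cy /eqP pxy]].
    have cx : x \in c.
      by apply: contraT => ncx; rewrite -fxy pos_f // eqxx in nxy.
    by rewrite -fxy pos_next // or_mem_f.
  by apply: pos_inj_c; rewrite ?or_mem_f // pos_next.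
rewrite !step //; last by rewrite eq_sym.
by case: (a \in c); case: (b \in c); rewrite ?andbF.
Qed.

(** The embedded trees partition the vertices; edges between different fibres are cycle edges by
    [adj_pos_neq]. *)
Lemma glue (ts : seq rooted_graph) : size ts = l ->
  (forall i : 'I_(size ts), tree_at i (nth K1 ts i)) -> G ~= H ts.
Proof.
move=> sz /fin_all_exists[g gP]; apply: iso_sym.
pose F (z : H_vertex ts) : G := g (tag z) (tagged z).
have Fpos z : pos (F z) = tag z by have [_ _ ->] := gP (tag z).
have Finj : injective F.
  move=> z z' Fzz; have := congr1 pos Fzz; rewrite !Fpos => /val_inj.
  case: z z' Fzz => [i u] [j v] /= Fzz ij; subst j; congr existT.
  by have [ginj _ _ _ _] := gP i; apply: ginj.
exists F.
  apply: inj_card_bij Finj _; apply: leq_trans (leq_image_card F xpredT).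
  apply/subset_leq_card/subsetP => u _; apply/imageP.
  have ul : pos u < size ts by rewrite sz pos_lt.
  have [_ _ _ gsurj _] := gP (Ordinal ul); have [x gx] := gsurj u (erefl _).
  by exists (Tagged (fun i : 'I_(size ts) => vertex (nth K1 ts i)) x).
have root_c z : (F z \in c) = at_root z.
  case: z => i u; rewrite /F /at_root /=; have [ginj gc gpos _ _] := gP i.
  apply/idP/eqP => [cu|->//]; apply: ginj; apply: pos_inj_c => //.
  by rewrite !gpos.
move=> z z'; rewrite -[RHS]/(H_adj z z') /H_adj; have [ezz|nzz] := eqVneq (tag z) (tag z').
  case: z z' ezz {Fpos root_c} => [i u] [j v] /= ij; subst j.
  rewrite tagged_asE /consecutive eqxx /= !andbF orbF.
  by have [_ _ _ _ ->] := gP i.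
rewrite adj_pos_neq ?Fpos // !root_c /=.
by rewrite /consecutive nzz -!val_eqE /= -sz.
Qed.

Variable i : nat.
Hypothesis il : i < l.
Let ci := nth (c_inhab O) c i.

Let ci_c : ci \in c. Proof. by rewrite mem_nth. Qed.
Let ci_pos : pos ci = i. Proof. exact: pos_nth. Qed.
Let eq_ci u : u \in c -> pos u = i -> u = ci.
Proof. by move=> cu pu; apply: pos_inj_c; rewrite ?ci_pos. Qed.

Lemma tree_at_K1 : weight i = 1 -> tree_at i K1.
Proof.
move/eqP/card1P=> -[u0 wE]; exists (fun=> ci); split=> //.
- by move=> x y _; rewrite !ord1.
- move=> u pu; exists ord0; have := wE u; have := wE ci.
  by rewrite !inE pu ci_pos eqxx => /esym/eqP-> /esym/eqP.
- by move=> x y; rewrite adj_irrefl !ord1.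
Qed.

(** Each child x of [ci] off the cycle starts a branch. Since [s x <= 2], that branch is a path with
    [s x] edges counted from [ci], so the branch lengths are the subtree sizes of these children. *)
Lemma tree_at_star :
  (forall x, x \notin c -> pos x = i -> s x <= 2) ->
  exists ls, [/\ size ls = (deg ci) - 2,
    forall k, k \in ls -> exists x, [/\ x \notin c, pos x = i & s x = k]
    & tree_at i (subdivided_star ls)].
Proof.
move=> sh.
pose lv := enum [pred x | (x \notin c) && (f x == ci)].
have lvP x : reflect (x \notin c /\ f x = ci) (x \in lv).
  by rewrite mem_enum inE; apply: (iffP andP) => -[? /eqP].
have lv_pos x : x \in lv -> pos x = i.
  by case/lvP => ncx fx; rewrite -(pos_f O ncx) fx.
exists (map s lv); split.
- by rewrite size_map -cardE (deg_c O) // subn2.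
- move=> _ /mapP[x lvx ->]; exists x; split=> //; last exact: lv_pos.
  by case/lvP: lvx.
(* The default [ci] occurs only if x has no child off the cycle, which [1 < s x] excludes. *)
pose child x := odflt ci [pick u | (u \notin c) && (f u == x)].
have childP x : x \notin c -> 1 < s x -> child x \notin c /\ f (child x) = x.
  move=> ncx sx; rewrite /child; case: pickP => [u /andP[? /eqP]//|none].
  have [|u fu ncu] := subtree_child O ncx; first by rewrite gtn_eqF.
  by have := none u; rewrite fu eqxx ncu.
pose ls := map s lv.
pose V := {k : 'I_(size ls) & 'I_(nth 0 ls k)}.
pose X (v : V) := nth ci lv (tag v).
have Xk (v : V) : tag v < size lv by apply: leq_trans (ltn_ord (tag v)) _; rewrite size_map.
have Xlv (v : V) : X v \in lv by apply: mem_nth.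
have Xs (v : V) : tagged v < s (X v).
  by apply: leq_trans (ltn_ord (tagged v)) _; rewrite (nth_map ci).
have Xnc (v : V) : X v \notin c by case/lvP: (Xlv v).
have fX (v : V) : f (X v) = ci by case/lvP: (Xlv v).
have Xsh (v : V) : s (X v) <= 2 by apply: sh; rewrite ?lv_pos.
have Xinj (v w : V) : X v = X w -> tag v = tag w.
  by move/eqP; rewrite nth_uniq ?enum_uniq // => /eqP/val_inj.
pose gs (v : V) := if tagged v == 0 :> nat then X v else child (X v).
have gs1 (v : V) : tagged v != 0 :> nat -> gs v \notin c /\ f (gs v) = X v.
  rewrite /gs => nv; rewrite (negPf nv); apply: childP => //.
  by apply: leq_trans (Xs v); rewrite ltnS lt0n.
have gsc (v : V) : gs v \notin c.
  by have [e|/gs1[]//] := boolP (tagged v == 0 :> nat); rewrite /gs e.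
have gspos (v : V) : pos (gs v) = i.
  have [e|/gs1[ncg fg]] := boolP (tagged v == 0 :> nat); first by rewrite /gs e lv_pos.
  by rewrite -(pos_f O ncg) fg lv_pos.
pose g (x : star_vertex ls) := if x is Some v then gs v else ci.
have gs_f (v : V) : (f (gs v) \in c) = (tagged v == 0 :> nat).
  have [e|nv] := boolP (tagged v == 0 :> nat); first by rewrite /gs e fX ci_c.
  by have [_ ->] := gs1 v nv; apply/negbTE.
have tag01 (v : V) : tagged v != 0 :> nat -> tagged v = 1 :> nat.
  by have := Xs v; have := Xsh v; lia.
exists g; split=> //.
- have gs_inj (v w : V) : gs v = gs w -> v = w.
    move=> e; have := congr1 (fun z => f z \in c) e; rewrite /= !gs_f => ze.
    have tv : tagged v = tagged w :> nat.
      have [v0|v1] := boolP (tagged v == 0 :> nat).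
        by move: (ze); rewrite v0 => /esym/eqP->; apply/eqP.
      by rewrite (tag01 v v1) (tag01 w) // -ze.
    have Xvw : X v = X w.
      have [v0|v1] := boolP (tagged v == 0 :> nat).
        by move: e; rewrite /gs -ze v0.
      have [_ <-] := gs1 v v1; rewrite e; have [|_ -> //] := gs1 w _.
      by rewrite -ze.
    have := Xinj v w Xvw; move: tv; case: v w {e ze Xvw} => [k a] [k' b] /= ab kk.
    by subst k'; congr existT; apply: val_inj.
  move=> [v|] [w|] //= e; first by rewrite (gs_inj v w e).
  + by have := gsc v; rewrite e ci_c.
  + by have := gsc w; rewrite -e ci_c.
- by case=> [v|] //=.
- move=> u pu; have [cu|ncu] := boolP (u \in c); first by exists None; rewrite /g (eq_ci cu).
  have inX x k : x \in lv -> k < s x ->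
      exists v : V, X v = x /\ tagged v = k :> nat.
    move=> lvx kx; have lti : index x lv < size ls by rewrite size_map index_mem.
    have ltk : k < nth 0 ls (Ordinal lti).
      by rewrite (nth_map ci) ?index_mem // nth_index.
    exists (Tagged (fun k : 'I_(size ls) => 'I_(nth 0 ls k)) (Ordinal ltk)).
    by rewrite /X /= nth_index.
  have [cfu|ncfu] := boolP (f u \in c).
    have lvu : u \in lv by apply/lvP; split=> //; apply: eq_ci; rewrite ?pos_f.
    have [v [Xv v0]] := inX u 0 lvu (subtree_gt0 f u).
    by exists (Some v); rewrite /= /gs v0.
  have nuf : u != f u.
    by apply: contraFneq (fconnect_fN O ncu) => {1}<-; rewrite connect0.
  have pfu : pos (f u) = i by rewrite pos_f.
  have sfu : 1 < s (f u).
    apply/card_gt1P; exists u, (f u); split=> //; rewrite inE ?connect0 //.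
    exact: fconnect1.
  have lvfu : f u \in lv.
    apply/lvP; split=> //; apply: eq_ci; last by rewrite pos_f.
    (* Otherwise u, [f u] and [f (f u)] would be three vertices in the subtree of the last one. *)
    apply: contraT => ncffu; have : s (f (f u)) <= 2 by apply: sh; rewrite ?pos_f.
    rewrite leqNgt => /negP[]; apply/card_gt2P; exists u, (f u), (f (f u)).
    split; split=> //; rewrite ?inE ?connect0 ?fconnect1 //.
    - exact: (fconnect_iter f 2 u).
    - by apply: contraFneq (fconnect_fN O ncfu) => {1}<-; rewrite connect0.
    - exact: ff_neq O u.
  have [v [Xv v1]] := inX (f u) 1 lvfu sfu.
  exists (Some v); have [//|_ fgv] := gs1 v; first by rewrite v1.
  (* If u were not the chosen child, [f u] would have two children, hence a subtree of at least
     three vertices. *)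
  rewrite /=; apply/eqP; apply: contraT => nuv.
  have : s (f u) <= 2 by apply: sh.
  rewrite leqNgt => /negP[]; apply/card_gt2P; exists u, (f u), (gs v).
  split; split; rewrite ?inE ?connect0 ?fconnect1 //.
  + by rewrite -Xv -fgv fconnect1.
  + rewrite -Xv -fgv; apply: contraFneq (fconnect_fN O (gsc v)) => ->.
    by rewrite connect0.
- have adjN (v : V) : adj ci (gs v) = (tagged v == 0 :> nat).
    rewrite (or_adj O) [f ci == _](negPf _) /=; last first.
      by apply: contraTneq (or_mem_f O ci_c) => ->.
    have [v0|nv] := boolP (tagged v == 0 :> nat); first by rewrite /gs v0 fX eqxx.
    have [_ ->] := gs1 v nv; apply/negbTE; apply: contraTneq ci_c => <-.
    exact: Xnc.
  have fgs (v w : V) : (f (gs v) == gs w) =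
      [&& tag v == tag w, tagged v == 1 :> nat & tagged w == 0 :> nat].
    have [v0|nv] := boolP (tagged v == 0 :> nat).
      rewrite {1}/gs v0 fX (eqP v0) /= andbF.
      by apply/negbTE; apply: contraTneq ci_c => ->.
    have [_ ->] := gs1 v nv; rewrite (tag01 v nv) eqxx /=.
    have [w0|nw] := boolP (tagged w == 0 :> nat); rewrite ?andbF ?andbT /gs.
      by rewrite w0; apply/eqP/eqP => [/Xinj//|e]; rewrite /X e.
    apply/negbTE; apply: contraTneq (Xnc w) => e.
    by have [_ fw] := gs1 w nw; rewrite -fw {1}/gs -e fX negbK ci_c.
  move=> [v|] [w|] //=; rewrite ?adj_irrefl //; last by rewrite adj_sym adjN.
  rewrite (or_adj O) !fgs /adj /= [tag w == tag v]eq_sym -andb_orr; congr andb.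
  have : tagged v < 2 := leq_trans (Xs v) (Xsh v).
  have : tagged w < 2 := leq_trans (Xs w) (Xsh w).
  by move: (tagged v : nat) (tagged w : nat) => [|[|a]] [|[|b]].
Qed.

End Glue.

Section SmallTrees.
Variables (G : sgraph) (f : G -> G) (c : seq G) (O : orientation f c).
Local Notation l := (size c).
Variable i : nat.
Hypothesis il : i < l.
Let ci := nth (c_inhab O) c i.

Lemma tree_at_K2 : weight O i = 2 -> tree_at O i K2.
Proof.
have cic : ci \in c by rewrite mem_nth.
have pci : pos O ci = i by apply: pos_nth.
move=> w2; have : #|[predD1 [pred u | pos O u == i] & ci]| = 1.
  by move: w2; rewrite /weight (cardD1 ci) inE pci eqxx => -[].
move/eqP/card1P => -[u uE].
have wE v : (pos O v == i) = (v == ci) || (v == u).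
  have := uE v; rewrite !inE; case: (v =P ci) => [->|_ <- //].
  by rewrite pci eqxx.
have /andP[nuc /eqP pu] : (u != ci) && (pos O u == i) by have := uE u; rewrite !inE eqxx.
have ncu : u \notin c.
  by apply: contra nuc => cu; apply/eqP; apply: (@pos_inj_c _ _ _ O); rewrite ?pu.
have fu : f u = ci.
  have := wE (f u); rewrite pos_f // pu eqxx => /esym/orP[/eqP//|/eqP fu].
  by have := fconnect_fN O ncu; rewrite fu connect0.
have cu_adj : adj ci u by rewrite (or_adj O) fu eqxx orbT.
have I2 (x : 'I_2) : x = ord0 \/ x = ord_max.
  by case: x => -[|[|//]] x2; [left|right]; apply: val_inj.
exists (fun x : 'I_2 => if x == ord0 then ci else u); split.
- by move=> x y; case: (I2 x) (I2 y) => -> [] -> //= e; rewrite e eqxx in nuc.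
- exact: cic.
- by move=> x; case: ifP.
- move=> v /eqP; rewrite wE => /orP[]/eqP->; first by exists ord0.
  by exists ord_max.
move=> x y; case: (I2 x) (I2 y) => -> [] -> /=; rewrite ?adj_irrefl //.
by rewrite adj_sym.
Qed.

Lemma tree_at_SB1 : (forall x, x \notin c -> subtree f x = 1) ->
  tree_at O i (SB 1 (weight O i).-1).
Proof.
move=> s1; have [x ncx _|ls [sz lsP Tls]] := @tree_at_star _ _ _ O i il; first by rewrite s1.
suff -> : SB 1 (weight O i).-1 = subdivided_star ls by [].
have -> : (weight O i).-1 = size ls; last first.
  congr subdivided_star; apply/esym/all_pred1P/allP => k /lsP[x [ncx _ <-]].
  by rewrite /= s1.
rewrite sz (deg_c_leaves O) ?mem_nth // pos_nth //; lia.
Qed.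

Lemma tree_at_K1K2 : weight O i = 1 \/ weight O i = 2 ->
  exists2 X, X = K1 \/ X = K2 & tree_at O i X.
Proof.
case=> w; [exists K1; [by left|exact: tree_at_K1]|].
by exists K2; [right|apply: tree_at_K2].
Qed.

End SmallTrees.

Lemma orientation_rot (G : sgraph) (f : G -> G) c k :
  orientation f c -> orientation f (rot k c).
Proof.
case=> adjE l3 Uc cyc reach; split; rewrite ?size_rot ?rot_uniq ?rot_cycle //.
by move=> x; have [m cm] := reach x; exists m; rewrite mem_rot.
Qed.

Lemma croot_mem (G : sgraph) (f : G -> G) c c' (O : orientation f c)
  (O' : orientation f c') : c =i c' -> croot O =1 croot O'.
Proof.
move=> cc x; elim/(or_ind O): x => [x cx|x ncx IH].
  by rewrite !croot_c // -cc.
by rewrite -(croot_f O ncx) IH croot_f -?cc.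
Qed.

Lemma weight_croot (G : sgraph) (f : G -> G) c (O : orientation f c) v :
  v \in c -> weight O (pos O v) = #|[pred u | croot O u == v]|.
Proof.
move=> cv; apply: eq_card => u; rewrite !inE [in LHS]/pos (croot_c O cv).
by apply/eqP/eqP => [/(index_inj_c (croot_in O u) cv)//|->].
Qed.

(** The starting point of the cycle is free: a rotation only permutes the weights, because [croot]
    depends only on the vertex set of the cycle. *)
Lemma orientation_max (G : sgraph) (f : G -> G) c : orientation f c ->
  exists c' (O : orientation f c'), forall i, i < size c' -> weight O i <= weight O 0.
Proof.
move=> O; pose W v := #|[pred u | croot O u == v]|.
have cx0 : nth (c_inhab O) c 0 \in c by rewrite mem_nth // (ltn_trans _ (or_size O)).
case: (arg_maxnP (P := [pred v | v \in c]) W cx0) => v cv vmax.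
have [k p rotE] := rot_to cv; pose O' := orientation_rot k O.
exists (rot k c), O' => i il.
have mem : c =i rot k c by move=> x; rewrite mem_rot.
have WE x : x \in c -> weight O' (pos O' x) = W x.
  move=> cx; rewrite weight_croot -?mem //; apply: eq_card => u.
  by rewrite !inE (croot_mem O O' mem).
have v0 : pos O' v = 0 by rewrite pos_c -?mem // rotE /= eqxx.
rewrite -v0 WE // -(pos_nth O' v il) WE; last by rewrite mem mem_nth.
by apply: vmax; rewrite inE mem mem_nth.
Qed.

(** With the heaviest tree in front, a positive [extra i] would make [extra 0] positive too, and the
    pair (0, i) would contribute to the sum. *)
Lemma concentrated (G : sgraph) (f : G -> G) c (O : orientation f c) :
  (forall i, i < size c -> weight O i <= weight O 0) ->
  \sum_(i < size c) \sum_(j < size c) extra O i * extra O j * cyc_dist (size c) i j = 0 ->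
  forall i, 0 < i < size c -> weight O i = 1.
Proof.
move=> wmax /eqP; rewrite sum_nat_eq0 => /forallP E0 i /andP[i0 il].
have l0 : 0 < size c by apply: leq_trans il.
have := E0 (Ordinal l0); rewrite sum_nat_eq0 => /forallP/(_ (Ordinal il)) /=.
have := wmax i il; rewrite (weightE O il) (weightE O l0) ltnS.
have cd : 0 < cyc_dist (size c) 0 i by rewrite /cyc_dist; lia.
rewrite !muln_eq0 [cyc_dist _ _ _ == 0]gtn_eqF // orbF => le /orP[]/eqP; lia.
Qed.

(** * The graphs H(T_1, ..., T_l) *)

(** Parent functions can be spliced into the successor function of [H ts]; the adjacency clause
    masks the value of [p] at the root. *)
Definition rooted_tree (T : rooted_graph) : Prop :=
  exists p : T -> T,
    (forall x y, adj x y = (x != rg_root T) && (p x == y) || (y != rg_root T) && (p y == x))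
    /\ (forall x, exists k, iter k p x = rg_root T).

Lemma next_enum_ord n (i : 'I_n) : next (enum 'I_n) i = ordS i.
Proof.
apply: val_inj => /=; rewrite -[LHS]index_enum_ord index_next ?enum_uniq ?mem_enum //.
by rewrite index_enum_ord size_enum_ord.
Qed.

Lemma ordS_neq n (i : 'I_n) : 1 < n -> ordS i != i.
Proof.
move=> n2; rewrite -val_eqE /=; have := ltn_ord i.
have [e|ne] := eqVneq i.+1 n; first by rewrite e modnn; lia.
by move=> il; rewrite modn_small; lia.
Qed.

Lemma H_orientation (ts : seq rooted_graph) : 2 < size ts ->
  (forall i : 'I_(size ts), rooted_tree (nth K1 ts i)) ->
  exists (f : H ts -> H ts) (c : seq (H ts)) (O : orientation f c),
    [/\ size c = size ts, forall z, pos O z = tag z & forall z, (z \in c) = at_root z].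
Proof.
move=> l3 /fin_all_exists[p pP].
pose h (i : 'I_(size ts)) : H_vertex ts :=
  Tagged (fun i : 'I_(size ts) => vertex (nth K1 ts i)) (rg_root (nth K1 ts i)).
pose f (z : H_vertex ts) : H_vertex ts := if at_root z then h (ordS (tag z)) else
  Tagged (fun i : 'I_(size ts) => vertex (nth K1 ts i)) (p (tag z) (tagged z)).
pose c := map h (enum 'I_(size ts)).
have hE k z : (h k == z) = (k == tag z) && at_root z.
  case: z => j v; rewrite /at_root /=; have [ekj|nkj] := eqVneq k j.
    by subst j; rewrite eq_Tagged /= eq_sym.
  by apply/negbTE; apply: contraNneq nkj => /(congr1 tag) /= ->.
have h_inj : injective h by move=> i j /(congr1 tag).
have fH z z' : (f z == z') = if at_root z then (ordS (tag z) == tag z') && at_root z'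
    else (tag z == tag z') && (p (tag z) (tagged z) == tagged_as z z').
  rewrite /f; case: ifP => _; first exact: hE.
  case: z z' => [i u] [j v] /=; have [eij|nij] := eqVneq i j.
    by subst j; rewrite eq_Tagged tagged_asE.
  by apply/negbTE; apply: contraNneq nij => /(congr1 tag) /= ->.
have cE z : (z \in c) = at_root z.
  apply/mapP/idP => [[i _ ->]|rz]; first by rewrite /at_root /= eqxx.
  by exists (tag z); rewrite ?mem_enum //; apply/esym/eqP; rewrite hE eqxx.
have Uc : uniq c by rewrite map_inj_uniq ?enum_uniq.
have O : @orientation (H ts) f c.
  split=> //.
  - move=> z z'; rewrite -[LHS]/(H_adj z z') /H_adj !fH.
    case: z z' => [i u] [j v] /=; have [eij|nij] := eqVneq i j.
      subst j; rewrite !tagged_asE /consecutive ?eqxx /= ?andbF ?orbF.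
      have [-> _] := pP i; rewrite (negPf (ordS_neq i _)) 1?(ltn_trans _ l3) //=.
      by rewrite /at_root /=; do 2 case: ifP.
    rewrite /consecutive nij /=.
    by case: (at_root _); case: (at_root _); rewrite ?andbT ?andbF ?orbF.
  - by rewrite size_map size_enum_ord.
  - apply: cycle_from_next => // z; rewrite cE => rz.
    have -> : z = h (tag z) by apply/esym/eqP; rewrite hE eqxx.
    by rewrite next_map ?enum_uniq // next_enum_ord /= fH /at_root /= !eqxx.
  - case=> i u; have [_ /(_ u)[k]] := pP i; elim: k u => [|k IHk] u.
      by move=> /= ->; exists 0; rewrite /= cE /at_root /= eqxx.
    rewrite iterSr => /IHk[m cm].
    have [ru|nru] := boolP (at_root (Tagged (fun i : 'I_(size ts) => vertex (nth K1 ts i)) u)).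
      by exists 0; rewrite /= cE.
    by exists m.+1; rewrite iterSr /f (negPf nru).
exists f, c, O; split=> //; first by rewrite size_map size_enum_ord.
elim/(or_ind O) => [z cz|z ncz].
  rewrite pos_c //; have -> : z = h (tag z) by apply/esym/eqP; rewrite hE eqxx -cE.
  by rewrite index_map // index_enum_ord.
by rewrite pos_f // => ->; rewrite /f -cE (negPf ncz).
Qed.

Lemma rooted_tree_K1 : rooted_tree K1.
Proof.
exists id; split=> [x y|x]; last by exists 0; rewrite ord1.
by rewrite !ord1 adj_irrefl.
Qed.

Lemma rooted_tree_K2 : rooted_tree K2.
Proof.
exists (fun=> ord0); split=> [[[|[|//]] ?] [[|[|//]] ?]|x] //.
by exists 1.
Qed.

Lemma rooted_tree_star ls : rooted_tree (subdivided_star ls).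
Proof.
pose V := {i : 'I_(size ls) & 'I_(nth 0 ls i)}.
have pred_lt (v : V) : (tagged v).-1 < nth 0 ls (tag v).
  exact: leq_ltn_trans (leq_pred _) (ltn_ord _).
pose p (x : star_vertex ls) : star_vertex ls :=
  if x is Some v then if tagged v == 0 :> nat then None
    else Some (Tagged (fun i : 'I_(size ls) => 'I_(nth 0 ls i)) (Ordinal (pred_lt v)))
  else None.
exists p; split.
  have pE (v w : V) : (p (Some v) == Some w) =
      (tag v == tag w) && ((tagged w).+1 == tagged v :> nat).
    rewrite /p; case: v w => [i j] [k m] /=.
    case: (eqVneq (j : nat) 0) => [j0|nj] /=; first by rewrite j0 /= andbF.
    have [eik|nik] := eqVneq i k; last first.
      by apply/negbTE; apply: contraNneq nik => /Some_inj/(congr1 tag) /= ->.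
    subst k; rewrite (inj_eq Some_inj) eq_Tagged -val_eqE /=.
    by apply/eqP/eqP; lia.
  move=> [v|] [w|]; rewrite -[LHS]/(star_adj _ _) ?pE //=.
  - by rewrite [tag w == tag v]eq_sym -andb_orr orbC.
  - by rewrite orbF; case: ifP.
  - by case: ifP.
case=> [[i j]|]; last by exists 0.
case: j => m; elim: m => [|m IHm] lt_m; first by exists 1.
have lt_m' := ltnW lt_m; have [k kE] := IHm lt_m'; exists k.+1; rewrite iterSr -kE.
congr iter; rewrite /p /=; congr (Some (existT _ _ _)); exact: val_inj.
Qed.

(** * Subtree sizes, degrees and Wiener index for shallow trees *)

Section Shapes.
Variables (G : sgraph) (f : G -> G) (c : seq G) (O : orientation f c).
Local Notation n := #|G|.
Local Notation l := (size c).
Local Notation s := (subtree f).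

(** The orientation of [H ts] is known only to exist, so subtree sizes have to be read off from
    adjacency: a non-leaf off the cycle has a child adjacent to it. *)
Lemma leaves_of_adj : (forall x y, x \notin c -> y \notin c -> ~~ adj x y) ->
  forall x, x \notin c -> s x = 1.
Proof.
move=> flat x ncx; apply/eqP; apply: contraT => /(subtree_child O ncx)[u fu ncu].
by have := flat u x ncu ncx; rewrite -fu (adj_f O).
Qed.

Lemma short_of_adj :
  (forall x y z, x \notin c -> y \notin c -> z \notin c -> adj x y -> adj x z -> y = z) ->
  short f c.
Proof.
move=> narrow; apply/forallP => x; apply/implyP => ncx.
have [->//|nsx] := eqVneq (s x) 1; have [w fw ncw] := subtree_child O ncx nsx.
have adjx u : f u = x -> adj x u by move=> <-; rewrite adj_sym (adj_f O).
have : #|[set x; w]| <= 2 by rewrite cards2; case: (x != w).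
apply: leq_trans; apply/subset_leq_card/subsetP => u; rewrite !inE => ux.
have := iter_findex ux; case: (findex f u x) => [/= ->|[|k] /= fk]; first by rewrite eqxx.
  have ncu : u \notin c by apply: contra ncx; apply: (fconnect_c O).
  by rewrite (narrow x u w) ?adjx ?eqxx ?orbT.
(* Two levels below x, the vertex [f a] would have both a and x as neighbours off the cycle, whence
   [a = x], against [ff_neq]. *)
set a := iter k f u in fk; have ax : fconnect f a x by rewrite -fk (fconnect_iter f 2).
have nca : a \notin c by apply: contra ncx; apply: (fconnect_c O).
have ncfa : f a \notin c by apply: contra ncx; rewrite -fk; apply: (or_mem_f O).
have e : a = x.
  by apply: (narrow (f a)) => //; [rewrite adj_sym (adj_f O)|rewrite -fk (adj_f O)].
by have := ff_neq O a; rewrite fk e eqxx.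
Qed.

Lemma n_leaf_all : (forall x, x \notin c -> s x = 1) -> n_leaf f c = n - l.
Proof.
move=> s1; rewrite -(card_notin_c O); apply: eq_card => x; rewrite !inE.
by case cx: (x \in c) => //=; rewrite s1 ?cx.
Qed.

Lemma short_all : (forall x, x \notin c -> s x = 1) -> short f c.
Proof. by move=> s1; apply/forallP => x; apply/implyP => /s1->. Qed.

Lemma double_wiener_leaves : (forall x, x \notin c -> s x = 1) ->
  2 * wiener G = 2 * ((n - l) * (n - 1)) + cyc_part O.
Proof.
move=> s1; rewrite (double_wienerE O) (tree_part_short O) ?short_all //.
by rewrite n_leaf_all // subnn addn0.
Qed.

Lemma n_even_leaves : (forall x, x \notin c -> s x = 1) ->
  n_even G = \sum_(i < l) odd (weight O i).
Proof.
move=> s1; pose g (i : 'I_l) := nth (c_inhab O) c i.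
have g_inj : injective g.
  by move=> i j /eqP; rewrite nth_uniq ?(or_uniq O) // => /eqP/val_inj.
have gc i : g i \in c by rewrite mem_nth.
transitivity #|[pred i : 'I_l | odd (weight O i)]|; last first.
  by rewrite -sum1_card big_mkcond; apply: eq_bigr => i _; rewrite inE; case: odd.
rewrite -(card_image g_inj); apply: eq_card => x; rewrite !inE.
apply/idP/imageP => [evx|[i wi ->]]; last first.
  by rewrite (deg_c_leaves O) // pos_nth //= negbK.
have cx : x \in c by apply: contraLR evx => ncx; rewrite (leaf_deg O) // s1.
have ix : index x c < l by rewrite index_mem.
exists (Ordinal ix); last by rewrite /g /= nth_index.
by move: evx; rewrite inE (deg_c_leaves O) //= negbK pos_c.
Qed.

Let c0 := nth (c_inhab O) c 0.

(** All degrees except that of [c0] are known. [F] stays free for two uses: the identity determines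
    [deg c0] through the degree sum, and parity then counts the odd vertices. *)
Lemma sum_deg_concentrated (F : nat -> nat) : short f c ->
  (forall i, 0 < i < l -> weight O i = 1) ->
  \sum_(v : G) F (deg v) = F (deg c0) + (l - 1) * F 2
    + (n_leaf f c * F 1 + (n - l - n_leaf f c) * F 2).
Proof.
move=> /forallP sh w1; have l0 : 0 < l by have := or_size O; lia.
have cc0 : c0 \in c by rewrite mem_nth.
rewrite (bigID (mem c)) /=; congr addn.
  rewrite (bigD1 c0) //=; congr addn.
  rewrite (eq_bigr (fun=> F 2)) => [|v /andP[cv nv]].
    rewrite sum_nat_const -(card_c O); congr muln.
    by rewrite [in RHS](cardD1 c0) cc0 add1n subn1 /=; apply: eq_card => v; rewrite !inE andbC.
  rewrite (weight1_deg (O := O)) ?w1 // pos_lt andbT lt0n.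
  apply: contra nv => /eqP pv; apply/eqP; apply: (@pos_inj_c _ _ _ O) => //.
  by rewrite pv pos_nth.
rewrite (bigID (fun x => s x == 1)) /=; congr addn.
  rewrite (eq_bigr (fun=> F 1)) => [|x /andP[ncx /eqP sx]]; last by rewrite (leaf_deg O).
  by rewrite sum_nat_const.
rewrite (eq_bigr (fun=> F 2)) => [|x /andP[ncx nsx]].
  rewrite sum_nat_const; congr muln; rewrite -(card_notin_c O) /n_leaf.
  rewrite -(cardID (fun x => s x == 1) [pred x | x \notin c]).
  rewrite [X in _ = X + _ - _](_ : _ = n_leaf f c); last by apply: eq_card => x; rewrite !inE andbC.
  by rewrite addKn; apply: eq_card => x; rewrite !inE andbC.
rewrite (subtree2_deg O) //; have := sh x; have := subtree_gt0 f x; rewrite ncx.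
by case: (s x) nsx => [|[|[|]]].
Qed.

Lemma deg_concentrated : short f c -> (forall i, 0 < i < l -> weight O i = 1) ->
  deg c0 = (n_leaf f c).+2.
Proof.
move=> sh w1; have := sum_deg_concentrated (fun k => k) sh w1; rewrite (sum_deg O).
by have := n_leaf_c O; have := or_size O; lia.
Qed.

Lemma n_odd_concentrated : short f c -> (forall i, 0 < i < l -> weight O i = 1) ->
  n_odd G = n_leaf f c + odd (n_leaf f c).
Proof.
move=> sh w1; have := sum_deg_concentrated (fun k => odd k : nat) sh w1.
rewrite deg_concentrated //= !muln0 muln1 negbK !addn0 addnC => <-.
by rewrite /n_odd -sum1_card big_mkcond; apply: eq_bigr => i _; rewrite inE; case: odd.
Qed.

Lemma cyc_part_concentrated : (forall i, 0 < i < l -> weight O i = 1) ->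
  cyc_part O = (2 * n - l) * cyc_sum l.
Proof.
move=> w1; rewrite cyc_partE [X in _ + X]big1 ?addn0 // => i _.
rewrite big1 // => j _; have [i0|i0] := posnP i; last first.
  by rewrite /extra w1 ?i0 /=.
have [j0|j0] := posnP j; last by rewrite /extra (w1 j) ?j0 //= muln0.
by rewrite i0 j0 /cyc_dist subnn min0n muln0.
Qed.

End Shapes.

Definition flat (T : rooted_graph) := forall x y : T,
  x != rg_root T -> y != rg_root T -> ~~ adj x y.

(** Away from the root the edges form a matching: the adjacency version of branches of length at
    most 2. *)
Definition narrow (T : rooted_graph) := forall x y z : T,
  x != rg_root T -> y != rg_root T -> z != rg_root T -> adj x y -> adj x z -> y = z.

Lemma flat_narrow T : flat T -> narrow T.
Proof. by move=> fl x y z rx ry _ xy; have := fl x y rx ry; rewrite xy. Qed.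

Lemma flat_K1 : flat K1.
Proof. by move=> x y; rewrite [x]ord1. Qed.

Lemma flat_K2 : flat K2.
Proof. by move=> [[|[|//]] ?] [[|[|//]] ?]. Qed.

Lemma flat_SB1 b : flat (SB 1 b).
Proof.
have t0 (v : {i : 'I_(size (nseq b 1)) & 'I_(nth 0 (nseq b 1) i)}) : tagged v = 0 :> nat.
  have := ltn_ord (tagged v); rewrite {2}nth_nseq; case: ifP => _; lia.
by move=> [v|] [w|] //= _ _; rewrite /adj /= !t0 andbF.
Qed.

Lemma narrow_star ls : all (fun k => k <= 2) ls -> narrow (subdivided_star ls).
Proof.
move=> /allP ls2; have t2 (v : {i : 'I_(size ls) & 'I_(nth 0 ls i)}) : tagged v < 2.
  by apply: leq_trans (ltn_ord (tagged v)) _; apply/ls2/mem_nth.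
move=> [v|] [w|] [w'|] //= _ _ _; rewrite /adj /=.
case: v w w' (t2 v) (t2 w) (t2 w') => [i j] [i1 j1] [i2 j2] /= lj lj1 lj2.
move=> /andP[/eqP e1 h1] /andP[/eqP e2 h2]; subst i1 i2.
by congr (Some (existT _ _ _)); apply: val_inj => /=; lia.
Qed.

Lemma H_adj_nonroot ts (x y : H ts) : ~~ at_root x ->
  adj x y -> exists e : tag y = tag x, adj (tagged x) (etagged e).
Proof.
case: x y => [i u] [j v] nrx; rewrite -[adj _ _]/(H_adj _ _) /H_adj (negPf nrx) /= orbF.
case/andP => /eqP eij; subst j; rewrite tagged_asE => uv; by exists (erefl i).
Qed.

Section HShape.
Variable ts : seq rooted_graph.
Variables (f : H ts -> H ts) (c : seq (H ts)) (O : orientation f c).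
Hypothesis sz : size c = size ts.
Hypothesis posE : forall z, pos O z = tag z.
Hypothesis cE : forall z, (z \in c) = at_root z.

Lemma H_weight (i : 'I_(size ts)) : weight O i = #|nth K1 ts i|.
Proof.
pose g (x : nth K1 ts i) : H ts :=
  Tagged (fun i : 'I_(size ts) => vertex (nth K1 ts i)) x.
have g_inj : injective g.
  by move=> x y /eqP; rewrite /g eq_Tagged /= => /eqP.
rewrite -(card_codom g_inj); apply: eq_card => z; rewrite inE posE.
apply/eqP/codomP => [ez|[x ->] //].
by case: z ez => j v /= /val_inj ej; subst j; exists v.
Qed.

Lemma H_leaves : (forall i : 'I_(size ts), flat (nth K1 ts i)) ->
  forall z, z \notin c -> subtree f z = 1.
Proof.
move=> fl; apply: (leaves_of_adj O) => x y; rewrite !cE => rx ry.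
apply/negP => /(H_adj_nonroot rx).
case: x y rx ry => [i u] [j v] rx ry /= [e]; subst j => /= uv.
by have := fl i u v rx ry; rewrite uv.
Qed.

Lemma H_short : (forall i : 'I_(size ts), narrow (nth K1 ts i)) -> short f c.
Proof.
move=> nw; apply: (short_of_adj O) => x y z; rewrite !cE => rx ry rz.
move=> /(H_adj_nonroot rx) + /(H_adj_nonroot rx).
case: x y z rx ry rz => [i u] [j v] [k w] rx ry rz /= [e] + [e'].
subst j k => /= uv uw; congr existT.
exact: (nw i u v w).
Qed.

End HShape.

(** For r = 0, 1 these are the values of triangles with leaves attached and weights (n - 4, 2, 2)
    and (n - 3, 1, 2), for r = 2, 3 with weights (n - 2, 1, 1); for r = 4, of a four-cycle with one
    star. For r >= 5 the terms come from n - r leaves, r - 5 vertices of subtree size 2, and half of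
    (2n - 5) * 6 for the five-cycle. *)
Definition min_wiener (n r : nat) : nat :=
  match r with
  | 0 => n * n - 9
  | 1 | 4 => n * n - n - 4
  | 2 | 3 => n * n - 2 * n
  | _ => (n - r) * (n - 1) + 2 * (r - 5) * (n - 2) + 6 * n - 15
  end.

(** * Values of the listed graphs *)

Definition optimal (K : sgraph) (n r : nat) : Prop :=
  in_U n r K /\ wiener K = min_wiener n r.

Lemma card_K1 : #|K1| = 1. Proof. exact: card_ord. Qed.
Lemma card_K2 : #|K2| = 2. Proof. exact: card_ord. Qed.

Lemma card_star ls : #|subdivided_star ls| = (sumn ls).+1.
Proof.
rewrite /= card_option card_tagged sumnE big_map big_enum /=; congr S.
under eq_bigr => i _ do rewrite card_ord.
by rewrite sumnE (big_nth 0) big_mkord.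
Qed.

Lemma card_SB1 b : #|SB 1 b| = b.+1.
Proof. by rewrite card_star sumn_nseq mul1n. Qed.

Lemma cyc_sum3 : cyc_sum 3 = 2. Proof. by have := cyc_sumE 3; rewrite /=; lia. Qed.
Lemma cyc_sum4 : cyc_sum 4 = 4. Proof. by have := cyc_sumE 4; rewrite /=; lia. Qed.
Lemma cyc_sum5 : cyc_sum 5 = 6. Proof. by have := cyc_sumE 5; rewrite /=; lia. Qed.

Lemma weighted_cyc3 (w : nat -> nat) :
  \sum_(i < 3) \sum_(j < 3) w i * w j * cyc_dist 3 i j =
  2 * (w 0 * w 1 + w 0 * w 2 + w 1 * w 2).
Proof.
rewrite !big_ord_recl !big_ord0 /= /bump /= !add1n.
have -> : cyc_dist 3 0 0 = 0 by []. have -> : cyc_dist 3 1 1 = 0 by [].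
have -> : cyc_dist 3 2 2 = 0 by []. have -> : cyc_dist 3 0 1 = 1 by [].
have -> : cyc_dist 3 0 2 = 1 by []. have -> : cyc_dist 3 1 2 = 1 by [].
rewrite ![cyc_dist 3 _ 0]cyc_distC [cyc_dist 3 2 1]cyc_distC.
by rewrite -!/(cyc_dist 3 0 1) /cyc_dist /=; lia.
Qed.

Lemma H_leaf (ts : seq rooted_graph) : 2 < size ts ->
  (forall i : 'I_(size ts), rooted_tree (nth K1 ts i)) ->
  (forall i : 'I_(size ts), flat (nth K1 ts i)) ->
  [/\ unicyclic (H ts), #|H ts| = \sum_(i < size ts) #|nth K1 ts i|,
      n_even (H ts) = \sum_(i < size ts) odd #|nth K1 ts i|
    & 2 * wiener (H ts) = 2 * ((#|H ts| - size ts) * (#|H ts| - 1))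
      + \sum_(i < size ts) \sum_(j < size ts)
          #|nth K1 ts i| * #|nth K1 ts j| * cyc_dist (size ts) i j].
Proof.
move=> l3 tr fl; have [f [c [O [sz posE cE]]]] := H_orientation l3 tr.
have wE i : i < size ts -> weight O i = #|nth K1 ts i|.
  by move=> il; rewrite -(H_weight posE (Ordinal il)).
have leaf := H_leaves O cE fl; split.
- exact: orientation_unicyclic O.
- by rewrite -(sum_weight O) sz; apply: eq_bigr => i _; rewrite wE.
- by rewrite (n_even_leaves O leaf) sz; apply: eq_bigr => i _; rewrite wE.
rewrite (double_wiener_leaves O leaf) cyc_part_weight sz; congr addn.
by do 2 (apply: eq_bigr => ? _); rewrite !wE.
Qed.

Lemma H3_leaf b X1 X2 : X1 = K1 \/ X1 = K2 -> X2 = K1 \/ X2 = K2 ->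
  let n := b.+1 + #|X1| + #|X2| in
  [/\ unicyclic (H [:: SB 1 b; X1; X2]), #|H [:: SB 1 b; X1; X2]| = n,
     n_even (H [:: SB 1 b; X1; X2]) = odd b.+1 + odd #|X1| + odd #|X2|
   & 2 * wiener (H [:: SB 1 b; X1; X2]) = 2 * ((n - 3) * (n - 1))
      + 2 * (b.+1 * #|X1| + b.+1 * #|X2| + #|X1| * #|X2|)].
Proof.
move=> hX1 hX2 n.
have [//|||u cH eH wH] := @H_leaf [:: SB 1 b; X1; X2].
- case=> -[|[|[|//]]] /= _; first exact: rooted_tree_star.
    by case: hX1 => ->; [apply: rooted_tree_K1|apply: rooted_tree_K2].
  by case: hX2 => ->; [apply: rooted_tree_K1|apply: rooted_tree_K2].
- case=> -[|[|[|//]]] /= _; first exact: flat_SB1.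
    by case: hX1 => ->; [apply: flat_K1|apply: flat_K2].
  by case: hX2 => ->; [apply: flat_K1|apply: flat_K2].
have cn : #|H [:: SB 1 b; X1; X2]| = n.
  by rewrite cH !big_ord_recl big_ord0 /= card_SB1 addn0 addnA.
split=> //; first by rewrite eH !big_ord_recl big_ord0 /= card_SB1 addn0 addnA.
rewrite wH cn (weighted_cyc3 (fun i => #|nth K1 [:: SB 1 b; X1; X2] i|)).
by rewrite /= card_SB1.
Qed.

Lemma optimal_H3_odd b X1 X2 : odd b -> X1 = K1 \/ X1 = K2 -> X2 = K1 \/ X2 = K2 ->
  optimal (H [:: SB 1 b; X1; X2]) (b.+1 + #|X1| + #|X2|) (odd #|X1| + odd #|X2|).
Proof.
move=> ob hX1 hX2; have [u cH eH wH] := H3_leaf b hX1 hX2.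
split; first by split=> //; rewrite -/(n_even _) eH /= ob.
move: wH; case: hX1 hX2 => -> [] ->; rewrite ?card_K1 ?card_K2 /min_wiener /=; nia.
Qed.

Lemma deg_star_root ls : all (fun k => 0 < k) ls ->
  deg (rg_root (subdivided_star ls)) = size ls.
Proof.
move=> /allP ls0; have k0 (k : 'I_(size ls)) : 0 < nth 0 ls k by apply/ls0/mem_nth.
pose h (k : 'I_(size ls)) : star_vertex ls :=
  Some (Tagged (fun k : 'I_(size ls) => 'I_(nth 0 ls k)) (Ordinal (k0 k))).
have h_inj : injective h by move=> k k' /Some_inj/(congr1 tag).
rewrite -[RHS]card_ord -(card_codom h_inj); apply: eq_card => x; rewrite inE.
apply/idP/codomP => [|[k ->] //]; case: x => [[k j]|] //= j0.
by exists k; congr (Some (existT _ _ _)); apply: val_inj; apply/eqP.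
Qed.

Lemma deg_K2_root : deg (rg_root K2) = 1.
Proof.
rewrite -(card1 (ord_max : 'I_2)); apply: eq_card => -[[|[|//]] ?]; exact: erefl.
Qed.

(** Each neighbour of the root in T leads to exactly one leaf, so the root degree counts the leaves.
    The clause [b + k < n] certifies that [n - k.+1 - b] is not truncated. *)
Lemma H_concentrated (T : rooted_graph) k : rooted_tree T -> narrow T -> 2 <= k ->
  let K := H (T :: nseq k K1) in
  let n := #|T| + k in
  let b := deg (rg_root T) in
  [/\ unicyclic K, #|K| = n, n_odd K = b + odd b, b + k < n
    & 2 * wiener K = 2 * (b * (n - 1) + (n - k.+1 - b) * (2 * (n - 2)))
        + (2 * n - k.+1) * cyc_sum k.+1].
Proof.
move=> trT nwT k2 K n b.
have nthE i : 0 < i -> nth K1 (T :: nseq k K1) i = K1.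
  by case: i => //= i _; rewrite nth_nseq; case: ifP.
have szk : size (T :: nseq k K1) = k.+1 by rewrite /= size_nseq.
have [||f [c [O [sz posE cE]]]] := @H_orientation (T :: nseq k K1).
- by rewrite szk.
- by case=> -[|i] il //; rewrite nthE //; apply: rooted_tree_K1.
have l0 : 0 < size (T :: nseq k K1) by [].
have w1 i : 0 < i < size c -> weight O i = 1.
  by rewrite sz => /andP[i0 il]; rewrite (H_weight posE (Ordinal il)) nthE // card_K1.
have w0 : weight O 0 = #|T| by rewrite (H_weight posE (Ordinal l0)).
have sh : short f c.
  apply: (H_short O cE); case=> -[|i] il //; rewrite nthE //.
  exact/flat_narrow/flat_K1.
have cn : #|K| = n.
  rewrite -(sum_weight O) sz szk big_ord_recl w0 (eq_bigr (fun=> 1)).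
    by rewrite sum1_card card_ord.
  by move=> i _; apply: w1; rewrite sz szk ltn_ord andbT.
have szc : size c = k.+1 by rewrite sz.
pose c0 := nth (c_inhab O) c 0.
have cc0 : c0 \in c by rewrite mem_nth // szc.
have c0E : c0 = Tagged (fun i : 'I_(size (T :: nseq k K1)) =>
    vertex (nth K1 (T :: nseq k K1) i)) (rg_root T) (i := Ordinal l0).
  have := posE c0; rewrite pos_nth ?szc //; move: (cc0); rewrite cE /at_root.
  case: c0 {cc0} => i u /= /eqP -> i0.
  have -> : i = Ordinal l0 by apply: val_inj.
  by [].
have bE : n_leaf f c = b.
  have := deg_concentrated sh w1; rewrite (deg_c O) // => -[<-].
  pose g (x : T) : K := Tagged (fun i : 'I_(size (T :: nseq k K1)) =>
    vertex (nth K1 (T :: nseq k K1) i)) x (i := Ordinal l0).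
  have g_inj : injective g by move=> x y /eqP; rewrite eq_Tagged /= => /eqP.
  rewrite /b /deg -(card_image g_inj); apply: eq_card => z; rewrite !inE.
  have gadj x y : adj (g x) (g y) = adj x y.
    by rewrite -[LHS]/(H_adj _ _) /H_adj eqxx /= tagged_asE /consecutive eqxx !andbF orbF.
  apply/andP/imageP => [[ncz /eqP fz]|[x rx ->]].
    have := adj_f O z; rewrite fz -/c0 c0E => /H_adj_nonroot.
    rewrite -cE => /(_ ncz)[e]; case: z e {ncz fz} => j v /= e; subst j => /= vr.
    by exists v; rewrite // inE adj_sym.
  have ncg : g x \notin c.
    rewrite cE /at_root /=; apply: contraTneq rx => ->; by rewrite inE adj_irrefl.
  split=> //; have : adj (g x) c0 by rewrite c0E -/(g _) gadj adj_sym.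
  rewrite (or_adj O) => /orP[//|/eqP fc0].
  by have := or_mem_f O cc0; rewrite fc0 (negPf ncg).
split=> //.
- exact: orientation_unicyclic O.
- by rewrite (n_odd_concentrated sh w1) bE.
- by have := n_leaf_c O; rewrite bE szc cn; lia.
rewrite (double_wienerE O) (tree_part_short O sh) (cyc_part_concentrated w1).
by rewrite bE szc cn.
Qed.

Lemma narrow_SaB2 ls : all (fun k => (0 < k) && ((k == 2) || (k.+1 == 2))) ls ->
  narrow (subdivided_star ls).
Proof. by move=> h; apply: narrow_star; apply: sub_all h => k; lia. Qed.

Lemma in_U_n_odd K n r : unicyclic K -> #|K| = n -> n_odd K + r = n -> in_U n r K.
Proof. by move=> uK cK; rewrite -{1}cK -(n_oddD K) => /addnI->; split. Qed.

Lemma optimal_H3_even b : ~~ odd b -> optimal (H [:: SB 1 b; K1; K1]) (b + 3) 3.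
Proof.
move=> ob.
have [] := @H_concentrated _ 2 (rooted_tree_star _) (flat_narrow (@flat_SB1 b)) isT.
rewrite deg_star_root ?all_nseq ?orbT // size_nseq card_SB1 cyc_sum3 (negPf ob) addn0.
move=> uK cK oK _ wK.
have {}wK : 2 * wiener (H [:: SB 1 b; K1; K1]) = _ := wK.
split; first by apply: in_U_n_odd; rewrite // ?cK ?oK //; lia.
move: wK; rewrite /min_wiener.
have -> : b.+1 + 2 - 3 - b = 0 by lia. have -> : b.+1 + 2 - 1 = b + 2 by lia.
have -> : 2 * (b.+1 + 2) - 3 = 2 * b + 3 by lia. lia.
Qed.

Lemma optimal_H4 b : ~~ odd b -> optimal (H [:: SB 1 b; K1; K1; K1]) (b + 4) 4.
Proof.
move=> ob.
have [] := @H_concentrated _ 3 (rooted_tree_star _) (flat_narrow (@flat_SB1 b)) isT.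
rewrite deg_star_root ?all_nseq ?orbT // size_nseq card_SB1 cyc_sum4 (negPf ob) addn0.
move=> uK cK oK _ wK.
have {}wK : 2 * wiener (H [:: SB 1 b; K1; K1; K1]) = _ := wK.
split; first by apply: in_U_n_odd; rewrite // ?cK ?oK //; lia.
move: wK; rewrite /min_wiener.
have -> : b.+1 + 3 - 4 - b = 0 by lia. have -> : b.+1 + 3 - 1 = b + 3 by lia.
have -> : 2 * (b.+1 + 3) - 4 = 2 * b + 4 by lia. lia.
Qed.

(** An isolated minimizer: the five-cycle value n^2 - 10 meets the four-cycle value n^2 - n - 4
    exactly at n = 6. *)
Lemma optimal_H5_K2 : optimal (H [:: K2; K1; K1; K1; K1]) 6 4.
Proof.
have [] := @H_concentrated K2 4 rooted_tree_K2 (flat_narrow flat_K2) isT.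
rewrite deg_K2_root card_K2 cyc_sum5 => uK cK oK _ wK.
have {}wK : 2 * wiener (H [:: K2; K1; K1; K1; K1]) = _ := wK.
split; first by apply: in_U_n_odd; rewrite // oK.
by move: wK; rewrite /min_wiener; lia.
Qed.

Lemma optimal_H5 ls : all (fun k => (0 < k) && ((k == 2) || (k.+1 == 2))) ls ->
  ~~ odd (size ls) ->
  optimal (H [:: subdivided_star ls; K1; K1; K1; K1])
    (sumn ls + 5) (sumn ls + 5 - size ls).
Proof.
move=> ls12 ob.
have [] := @H_concentrated _ 4 (rooted_tree_star ls) (narrow_SaB2 ls12) isT.
rewrite deg_star_root; last by apply: sub_all ls12 => k /andP[].
rewrite card_star cyc_sum5 (negPf ob) addn0.
move=> uK cK oK bn wK.
have {}wK : 2 * wiener (H [:: subdivided_star ls; K1; K1; K1; K1]) = _ := wK.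
split; first by apply: in_U_n_odd; rewrite // ?cK ?oK //; lia.
(* [a] is the number of branches of length 2, so the number of even vertices is a + 5. *)
have [a aE] : exists a, sumn ls = size ls + a by exists (sumn ls - size ls); lia.
move: wK; rewrite aE /min_wiener.
have -> : size ls + a + 5 - size ls = a.+4.+1 by lia.
move: (size ls) => b wK.
have e1 : (b + a).+1 + 4 - 5 - b = a by lia.
have e2 : (b + a).+1 + 4 - 1 = b + a + 4 by lia.
have e3 : (b + a).+1 + 4 - 2 = b + a + 3 by lia.
have e4 : 2 * ((b + a).+1 + 4) - 5 = 2 * (b + a) + 5 by lia.
have e5 : b + a + 5 - a.+4.+1 = b by lia.
have e6 : b + a + 5 - 1 = b + a + 4 by lia.
have e7 : b + a + 5 - 2 = b + a + 3 by lia.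
have e8 : a.+4.+1 - 5 = a by lia.
by move: wK; rewrite e1 e2 e3 e4 e5 e6 e7 e8; lia.
Qed.

(** * The lower bound *)

(** Doubled comparison with the five-cycle, which costs 12n - 30. Each of the l - 5 further cycle
    vertices replaces a vertex of subtree size 2, worth 4(n - 2), and [m] is the shortfall of leaves
    below n - r, at 2(n - 3) each. For l = 6 and m = 0 the claim amounts to n > 8, and the side
    condition gives n >= 9. *)
Lemma long_cycle_cost n l m S : 6 <= l -> l < n -> 4 * S + odd l = l * l ->
  (2 * l <= n + 3) || (0 < m) ->
  12 * n + 4 * (l - 5) * (n - 2) < 2 * m * (n - 3) + (2 * n - l) * S + 30.
Proof.
(* Up to length 10, S is made explicit; from 11 on, [4 * l <= S + 14] suffices without the term in
   m. *)
move=> l6 ln SE; have [l11|] := ltnP 10 l; last first.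
  move=> l10; move: l6 l10 SE ln.
  case: l => [|[|[|[|[|[|[|[|[|[|[|//]]]]]]]]]]] // _ _ /= SE ln.
  - have -> : S = 9 by lia. case: m => [|m]; nia.
  - have -> : S = 12 by lia. case: m => [|m]; nia.
  - have -> : S = 16 by lia. case: m => [|m]; nia.
  - have -> : S = 20 by lia. case: m => [|m]; nia.
  - have -> : S = 25 by lia. case: m => [|m]; nia.
move=> _; apply: leq_trans (_ : (2 * n - l) * S + 30 <= _); last by rewrite -addnA leq_addl.
have [q qE] : exists q, l = q + 11 by exists (l - 11); lia.
have [k kE] : exists k, n = l + k by exists (n - l); lia.
have -> : 2 * n - l = l + 2 * k by lia.
have -> : l - 5 = q + 6 by lia.
have -> : n - 2 = q + 9 + k by lia.
have S2 : 4 * l <= S + 14 by case: (odd l) SE; nia.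
subst n l; nia.
Qed.

Lemma bound_ge5 n l L a S : 2 < l -> l <= n -> (l = n -> n <= 3) ->
  4 * S + odd l = l * l -> L + l <= n -> L + (a + 5) <= n -> 2 * (a + 5) <= n + 3 ->
  2 * ((n - (a + 5)) * (n - 1) + 2 * a * (n - 2) + 6 * n - 15)
    + (if (l == 5) && (L + (a + 5) == n) then 0 else 1)
  <= 2 * (L * (n - 1) + (n - l - L) * (2 * (n - 2))) + (2 * n - l) * S.
Proof.
move=> l3 ln nl SE Ll Lr hr.
(* With r = a + 5, M is the shortfall of leaves below n - r, and m below is the number of non-leaves
   off the cycle. *)
have [M ME] : exists M, n = L + (a + 5) + M by exists (n - (L + (a + 5))); lia.
have [m mE] : exists m, n = L + l + m by exists (n - (L + l)); lia.
have -> : n - (a + 5) = L + M by lia.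
have -> : n - l - L = m by lia.
have n7 : 7 <= n by lia.
have [k kE] : exists k, n = k + 3 by exists (n - 3); lia.
have k1 : n - 1 = k + 2 by lia. have k2 : n - 2 = k + 1 by lia.
have k3 : n - 3 = k by lia.
have eqL : (L + (a + 5) == n) = (M == 0) by lia.
rewrite eqL {eqL}.
have [l6|l5] := ltnP 5 l; last first.
  rewrite k1 k2; move: l3 l5 SE mE; case: l ln nl Ll => [|[|[|[|[|[|//]]]]]] //= ln nl Ll _ _ SE mE.
  - have -> : S = 2 by lia.
    have -> : 2 * n - 3 = 2 * k + 3 by lia. nia.
  - have -> : S = 4 by lia.
    have -> : 2 * n - 4 = 2 * k + 2 by lia. nia.
  - have -> : S = 6 by lia.
    have -> : 2 * n - 5 = 2 * k + 1 by lia.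
    case: (posnP M) => [->|M0]; first by rewrite /=; nia.
    nia.
have -> : (l == 5) = false by lia.
have ln' : l < n by lia.
(* If M = 0, then l <= n - L = a + 5, so the bound on r becomes a bound on l. *)
have side : (2 * l <= n + 3) || (0 < M) by lia.
have := @long_cycle_cost n l M S l6 ln' SE side.
rewrite k1 k2 k3 /=.
have [q qE] : exists q, l = q + 5 by exists (l - 5); lia.
have -> : l - 5 = q by lia.
move: ((2 * n - l) * S) => X; subst l.
(* Both factors equal n - L - 5: the vertices that are neither leaves nor among five cycle
   vertices. *)
have e : (m + q) * (k + 1) = (a + M) * (k + 1) by congr muln; lia.
lia.
Qed.

(** Excludes long cycles for all r from 1 to 4 at once: n^2 - n - 4 is the target for r = 1, 4 and,
    as n >= 4, at least the target n^2 - 2n for r = 2, 3. *)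
Lemma bound_long n l L S : 6 <= l -> 4 * S + odd l = l * l -> L + l <= n ->
  2 * (n * n - n - 4) < 2 * (L * (n - 1) + (n - l - L) * (2 * (n - 2))) + (2 * n - l) * S.
Proof.
move=> l6 SE Ll.
have [m mE] : exists m, n = L + l + m by exists (n - (L + l)); lia.
have -> : n - l - L = m by lia.
have [q qE] : exists q, l = q + 6 by exists (l - 6); lia.
have [k kE] : exists k, n = l + k by exists (n - l); lia.
have -> : n - 1 = q + 5 + k by lia.
have -> : n - 2 = q + 4 + k by lia.
have -> : 2 * n - l = l + 2 * k by lia.
(* Length six is the tight case, 72 < 74 with S = 9; from seven on, already 2l <= S + 2. *)
have S1 : l * (2 * l) < l * (S + 2) + 8.
  have [l7|le6] := ltnP 6 l; last first.
    have l6' : l = 6 by lia.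
    by move: SE; rewrite l6' /=; lia.
  have S1 : 2 * l <= S + 2 by case: (odd l) SE; nia.
  by have : l * (2 * l) <= l * (S + 2); [rewrite leq_mul2l S1 orbT|lia].
have S2 : l <= S by case: (odd l) SE; nia.
have LmE : L = k - m /\ m <= k by lia.
have -> : n * n - n - 4 = n * (q + 5 + k) - 4 by nia.
have tree : k * (q + 5 + k) <= L * (q + 5 + k) + m * (2 * (q + 4 + k)).
  have -> : k = L + m by lia.
  nia.
have l2 : k * l <= k * S by rewrite leq_mul2l S2 orbT.
have nE : n * (q + 5 + k) + l = k * (q + 5 + k) + l * (l + k).
  by rewrite kE qE; lia.
move: tree nE; set X := k * (q + 5 + k); set Y := L * _ + _; set Z := n * _ => tree nE.
have : 2 * l * l + 2 * (k * l) < (l + 2 * k) * S + 2 * l + 8 by lia.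
lia.
Qed.

(** The last term is the doubled price of non-leaves off the cycle: each costs 2(n - 2) instead of n
    - 1, that is n - 3 more. *)
Lemma bound_l3 n L : L + 3 <= n ->
  2 * (L * (n - 1) + (n - 3 - L) * (2 * (n - 2))) + (2 * n - 3) * 2
  = 2 * (n * n - 2 * n) + 2 * ((n - 3 - L) * (n - 3)).
Proof.
move=> Ln; have [m ->] : exists m, n = L + 3 + m by exists (n - (L + 3)); lia.
have -> : L + 3 + m - 3 - L = m by lia.
have -> : L + 3 + m - 1 = L + 2 + m by lia. have -> : L + 3 + m - 2 = L + 1 + m by lia.
have -> : L + 3 + m - 3 = L + m by lia. lia.
Qed.

Lemma bound_l4 n L : L + 4 <= n ->
  2 * (L * (n - 1) + (n - 4 - L) * (2 * (n - 2))) + (2 * n - 4) * 4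
  = 2 * (n * n - n - 4) + 2 * ((n - 4 - L) * (n - 3)).
Proof.
move=> Ln; have [m ->] : exists m, n = L + 4 + m by exists (n - (L + 4)); lia.
have -> : L + 4 + m - 4 - L = m by lia.
have -> : L + 4 + m - 1 = L + 3 + m by lia. have -> : L + 4 + m - 2 = L + 2 + m by lia.
have -> : L + 4 + m - 3 = L + 1 + m by lia. lia.
Qed.

Lemma bound_l5 n L : L + 5 <= n ->
  2 * (L * (n - 1) + (n - 5 - L) * (2 * (n - 2))) + (2 * n - 5) * 6
  = 2 * (n * n - 10) + 2 * ((n - 5 - L) * (n - 3)).
Proof.
move=> Ln; have [m ->] : exists m, n = L + 5 + m by exists (n - (L + 5)); lia.
have -> : L + 5 + m - 5 - L = m by lia.
have -> : L + 5 + m - 1 = L + 4 + m by lia. have -> : L + 5 + m - 2 = L + 3 + m by lia.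
have -> : L + 5 + m - 3 = L + 2 + m by lia. lia.
Qed.

Lemma bound_zero n l S : 4 <= l -> 2 * l <= n -> 4 * S + odd l = l * l ->
  2 * (n * n - 9) < 2 * ((n - l) * (n - 1)) + 4 * (n - l) * S.
Proof.
move=> l4 ln SE.
have [k ->] : exists k, n = 2 * l + k by exists (n - 2 * l); lia.
have -> : 2 * l + k - l = l + k by lia.
have S1 : 2 * l <= S + 4 by case: (odd l) SE; nia.
have : (l + k) * (2 * l) <= (l + k) * (S + 4) by rewrite leq_mul2l S1 orbT.
have [q ->] : exists q, l = q + 4 by exists (l - 4); lia.
have -> : 2 * (q + 4) + k - 1 = 2 * q + 7 + k by lia.
nia.
Qed.

(** With m, a, b the weights minus 2, the excess is ma + mb + ab; since a, b <= m, it vanishes only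
    for a = b = 0. *)
Lemma triangle_weights0 w0 w1 w2 : w1 <= w0 -> w2 <= w0 -> 1 < w1 -> 1 < w2 ->
  4 * (w0 + w1 + w2) <= w0 * w1 + w0 * w2 + w1 * w2 + 12 /\
  (w0 * w1 + w0 * w2 + w1 * w2 + 12 = 4 * (w0 + w1 + w2) -> w1 = 2 /\ w2 = 2).
Proof.
move=> h1 h2 g1 g2; have [a aE] : exists a, w1 = a + 2 by exists (w1 - 2); lia.
have [b bE] : exists b, w2 = b + 2 by exists (w2 - 2); lia.
subst w1 w2.
have [m mE] : exists m, w0 = m + 2 by exists (w0 - 2); lia.
have -> : w0 * (a + 2) + w0 * (b + 2) + (a + 2) * (b + 2) + 12
  = 4 * (w0 + (a + 2) + (b + 2)) + (m * a + m * b + a * b) by rewrite mE; lia.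
split; first by lia.
move=> e; have z : m * a + m * b + a * b = 0 by lia.
have am : a <= m by lia. have bm : b <= m by lia.
by split; nia.
Qed.

(** If [w1] or [w2] is 1, the excess is a product of the other two weights minus 2. If both are at
    least 2, [triangle_weights0] gives 4n - 12, which exceeds 3n - 7 as n >= 6, where n is the total
    weight. *)
Lemma triangle_weights1 w0 w1 w2 : w1 <= w0 -> w2 <= w0 -> 1 < w0 -> 0 < w1 -> 0 < w2 ->
  2 < w1 + w2 ->
  3 * (w0 + w1 + w2) <= w0 * w1 + w0 * w2 + w1 * w2 + 7 /\
  (w0 * w1 + w0 * w2 + w1 * w2 + 7 = 3 * (w0 + w1 + w2) ->
    (w1 = 1 /\ w2 = 2) \/ (w1 = 2 /\ w2 = 1)).
Proof.
move=> h1 h2 h0 p1 p2 p12.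
have [m mE] : exists m, w0 = m + 2 by exists (w0 - 2); lia.
have [e1|n1] := eqVneq w1 1.
  have [b bE] : exists b, w2 = b + 2 by exists (w2 - 2); lia.
  subst; have -> : (m + 2) * 1 + (m + 2) * (b + 2) + 1 * (b + 2) + 7
    = 3 * (m + 2 + 1 + (b + 2)) + m * b by lia.
  split; first by lia.
  move=> e; left; split=> //; have z : m * b = 0 by lia.
  nia.
have [e2|n2] := eqVneq w2 1.
  have [b bE] : exists b, w1 = b + 2 by exists (w1 - 2); lia.
  subst; have -> : (m + 2) * (b + 2) + (m + 2) * 1 + (b + 2) * 1 + 7
    = 3 * (m + 2 + (b + 2) + 1) + m * b by lia.
  split; first by lia.
  move=> e; right; split=> //; have z : m * b = 0 by lia.
  nia.
by have [] := @triangle_weights0 w0 w1 w2; lia.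
Qed.

Lemma ltn_bound m k (P : Prop) : m < k -> m <= k /\ (k = m -> P).
Proof. by move=> lt; split=> [|e]; [apply: ltnW|rewrite e ltnn in lt]. Qed.

Definition extremal (G : sgraph) : Prop :=
  (G ~= H [:: K2; K1; K1; K1; K1] \/
    exists (b1 : nat) (X1 X2 : rooted_graph),
      [/\ 1 <= b1, odd b1, X1 = K1 \/ X1 = K2, X2 = K1 \/ X2 = K2
        & G ~= H [:: SB 1 b1; X1; X2]])
  \/
  [\/ exists2 b2 : nat, ~~ odd b2 & G ~= H [:: SB 1 b2; K1; K1],
      exists2 b3 : nat, ~~ odd b3 & G ~= H [:: SB 1 b3; K1; K1; K1]
    | exists (b4 : nat) (S : rooted_graph),
        [/\ ~~ odd b4, is_SaB 2 b4 S & G ~= H [:: S; K1; K1; K1; K1]]].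

(** * Case analysis on the number of even vertices *)

Section Main.
Variables (G : sgraph) (f : G -> G) (c : seq G) (O : orientation f c).
Hypothesis wmax : forall i, i < size c -> weight O i <= weight O 0.
Local Notation n := #|G|.
Local Notation l := (size c).
Local Notation s := (subtree f).
Local Notation L := (n_leaf f c).
Local Notation r := (n_even G).
Local Notation w := (weight O).
Hypothesis hr : 2 * r <= n + 3.

Lemma leaves_of_n_leaf : n - l <= L -> forall x, x \notin c -> s x = 1.
Proof.
rewrite -(card_notin_c O) => le x ncx.
have sub : [pred x | (x \notin c) && (s x == 1)] \subset [pred x | x \notin c].
  by apply/subsetP => y; rewrite !inE => /andP[].
have /subset_cardP/(_ sub)/(_ x) : L = #|[pred x | x \notin c]|.
  by apply/eqP; rewrite eqn_leq le subset_leq_card.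
by rewrite !inE ncx /= => /eqP.
Qed.

(** All n vertices of a bare cycle are even, so [hr] reads 2n <= n + 3. *)
Lemma cycle_graph_small : l = n -> n <= 3.
Proof.
move=> ln; have /eqP : \sum_(i < l) extra O i = 0 by have := sum_extra O; lia.
rewrite sum_nat_eq0 => /forallP w0.
have : l <= r.
  apply: leq_trans (weight1_even O); rewrite -[X in X <= _](card_ord l).
  apply/subset_leq_card/subsetP => i _; rewrite inE (weightE O) //.
  by have := w0 i => /= /eqP->.
by move: hr; rewrite ln; lia.
Qed.

Lemma glue_SB1 (X : nat -> rooted_graph) : (forall x, x \notin c -> s x = 1) ->
  (forall i, 0 < i < l -> tree_at O i (X i)) ->
  G ~= H (SB 1 (w 0).-1 :: [seq X i | i <- iota 1 l.-1]).
Proof.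
move=> s1 tX; have l0 : 0 < l by have := or_size O; lia.
have sz : size (SB 1 (w 0).-1 :: [seq X i | i <- iota 1 l.-1]) = l.
  by rewrite /= size_map size_iota prednK.
apply: (glue (O := O) sz); case=> -[|i] il; first exact: tree_at_SB1.
have il' : i.+1 < l by rewrite -sz.
by rewrite /= (nth_map 0) ?size_iota ?nth_iota; [exact: tX|lia..].
Qed.

Local Notation E :=
  (\sum_(i < l) \sum_(j < l) extra O i * extra O j * cyc_dist l i j).

Lemma glue_concentrated (T : rooted_graph) k : l = k.+1 -> E = 0 ->
  tree_at O 0 T -> G ~= H (T :: nseq k K1).
Proof.
move=> lk E0 T0; have sz : size (T :: nseq k K1) = l by rewrite /= size_nseq.
apply: (glue (O := O) sz); case=> -[|i] il //.
have -> : nth K1 (T :: nseq k K1) (Ordinal il) = K1.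
  by rewrite /= nth_nseq; case: ifP.
have il' : i.+1 < l by rewrite -sz.
by apply: tree_at_K1 => //; apply: concentrated wmax E0 _ _.
Qed.

Lemma weight0_concentrated : E = 0 -> w 0 + l.-1 = n.
Proof.
move=> E0; rewrite -(sum_weight O).
have w1 i : 0 < i < l -> w i = 1 by apply: concentrated wmax E0 i.
have := or_size O; case: (size c) w1 => // k w1 _.
rewrite big_ord_recl (eq_bigr (fun=> 1)) => [|i _]; first by rewrite sum1_card card_ord.
by apply: w1; rewrite ltn_ord andbT.
Qed.

Lemma extremal5 : l = 5 -> L + r = n -> short f c -> E = 0 -> extremal G.
Proof.
move=> l5 Lr sh E0; have w1 i : 0 < i < l -> w i = 1 by apply: concentrated wmax E0 i.
have l0 : 0 < l by rewrite l5.
have [|ls [sz lsP T0]] := @tree_at_star _ _ _ O 0 l0.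
  by move=> x ncx _; have /forallP/(_ x) := sh; rewrite ncx.
rewrite (deg_concentrated sh w1) subn2 /= in sz.
right; apply: Or33; exists (size ls), (subdivided_star ls); split.
(* [L + r = n] says that there are as many leaves as odd vertices, an even number by the handshake
   lemma. *)
- have := even_n_odd O; have := n_oddD G; rewrite sz => rE.
  by have -> : L = n_odd G by lia.
- exists ls; split=> //; apply/allP => k /lsP[x [ncx _ <-]].
  have /forallP/(_ x) := sh; rewrite ncx /=; have := subtree_gt0 f x; lia.
exact: (@glue_concentrated _ 4).
Qed.

Lemma extremal4 : l = 4 -> n - l <= L -> E = 0 -> ~~ odd n -> extremal G.
Proof.
move=> l4 Ln E0 en; have w0 := weight0_concentrated E0.
right; apply: Or32; exists (w 0).-1.
  by have := weight_gt0 O (i := 0); move: en w0; rewrite l4 /=; lia.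
apply: (@glue_concentrated _ 3) => //; apply: tree_at_SB1; first by rewrite l4.
exact: leaves_of_n_leaf.
Qed.

Lemma extremal5_K2 : l = 5 -> n = 6 -> E = 0 -> extremal G.
Proof.
move=> l5 n6 E0; have w0 := weight0_concentrated E0.
left; left; apply: (@glue_concentrated _ 4) => //; apply: tree_at_K2; first by rewrite l5.
by move: w0; rewrite l5 n6 /=; lia.
Qed.

Lemma extremal3 : l = 3 -> n - l <= L -> odd (w 0).-1 ->
  w 1 = 1 \/ w 1 = 2 -> w 2 = 1 \/ w 2 = 2 -> extremal G.
Proof.
move=> l3 Ln ob w1 w2; have s1 := leaves_of_n_leaf Ln.
have [X1 hX1 T1] : exists2 X, X = K1 \/ X = K2 & tree_at O 1 X.
  by apply: tree_at_K1K2; rewrite ?l3.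
have [X2 hX2 T2] : exists2 X, X = K1 \/ X = K2 & tree_at O 2 X.
  by apply: tree_at_K1K2; rewrite ?l3.
left; right; exists (w 0).-1, X1, X2; split=> //; first by case: (w 0).-1 ob.
have := @glue_SB1 (nth K1 [:: X1; X1; X2]) s1; rewrite l3 /=; apply.
by case=> [|[|[|]]].
Qed.

(** The parity of the number of leaves decides the family: odd gives (a) with two trivial trees,
    even gives (b). *)
Lemma extremal3_even : l = 3 -> n - l <= L -> E = 0 -> extremal G.
Proof.
move=> l3 Ln E0; have w1 i : 0 < i < l -> w i = 1 by apply: concentrated wmax E0 i.
have [ob|eb] := boolP (odd (w 0).-1).
  by apply: extremal3 => //; left; apply: w1; rewrite l3.
right; apply: Or31; exists (w 0).-1 => //.
apply: (@glue_concentrated _ 2) => //; apply: tree_at_SB1; first by rewrite l3.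
exact: leaves_of_n_leaf.
Qed.

Lemma cyc_part3 : l = 3 -> cyc_part O = 2 * (w 0 * w 1 + w 0 * w 2 + w 1 * w 2).
Proof. by move=> l3; rewrite cyc_part_weight l3 weighted_cyc3. Qed.

(** Concentration leaves l - 1 trivial trees, each with an even cycle vertex. *)
Lemma not_concentrated : r = 1 -> E = 0 -> l <= 2.
Proof.
move=> r1 E0; have w1 i : 0 < i < l -> w i = 1 by apply: concentrated wmax E0 i.
have := weight1_le O; rewrite r1; case: (size c) w1 => // k w1; rewrite big_ord_recl.
rewrite (eq_bigr (fun=> 1)) => [|i _]; last by rewrite w1 // ltn_ord andbT.
by rewrite sum1_card card_ord; lia.
Qed.

Lemma wiener_ge : 2 * (L * (n - 1) + (n - l - L) * (2 * (n - 2)))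
  + (2 * n - l) * cyc_sum l + (2 * ~~ short f c + E) <= 2 * wiener G.
Proof.
have := tree_part_ge O; have := cyc_partE O; have := double_wienerE O; lia.
Qed.

Lemma tree_part_ge_leaves : (n - l) * (n - 1) + (L < n - l) <= tree_part f c.
Proof.
have Lc := n_leaf_c O; have l3 := or_size O.
apply: leq_trans (leq_trans (leq_addr _ _) (tree_part_ge O)).
have [m mE] : exists m, n = L + l + m by exists (n - (L + l)); lia.
have [k kE] : exists k, n = k + 3 by exists (n - 3); lia.
have -> : n - l - L = m by lia. have -> : n - l = L + m by lia.
have -> : n - 1 = k + 2 by lia. have -> : n - 2 = k + 1 by lia.
case: m mE => [|m] mE; first by rewrite !addn0 ltnn; lia.
have -> : (L < L + m.+1) = true by lia.
have : 0 < k by lia.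
nia.
Qed.

Lemma wiener_ge3 : l = 3 ->
  2 * (n * n - 2 * n) + E + (if L < n - 3 then 2 * (n - 3) else 0) <= 2 * wiener G.
Proof.
move=> l3; have := wiener_ge; have := n_leaf_c O; set e := E; rewrite l3 => Lc.
rewrite cyc_sum3 bound_l3 //; case: ltnP => Ln; last by lia.
have : 1 * (n - 3) <= (n - 3 - L) * (n - 3) by rewrite leq_mul2r; lia.
lia.
Qed.

Lemma wiener_ge4 : l = 4 ->
  2 * (n * n - n - 4) + E + (if L < n - 4 then 1 else 0) <= 2 * wiener G.
Proof.
move=> l4; have := wiener_ge; have := n_leaf_c O; set e := E; rewrite l4 => Lc.
rewrite cyc_sum4 bound_l4 //; case: ltnP => Ln; last by lia.
have : 1 * (n - 3) <= (n - 4 - L) * (n - 3) by rewrite leq_mul2r; lia.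
lia.
Qed.

Lemma wiener_ge5 : l = 5 -> 2 * (n * n - 10) + E <= 2 * wiener G.
Proof.
move=> l5; have := wiener_ge; have := n_leaf_c O; set e := E; rewrite l5 => Lc.
rewrite cyc_sum5 bound_l5 //; move: ((n - 5 - L) * _) => x; lia.
Qed.

Lemma wiener_gt_long : 5 < l -> 2 * (n * n - n - 4) < 2 * wiener G.
Proof.
move=> l6; apply: leq_trans (bound_long l6 (cyc_sumE l) (n_leaf_c O)) _.
exact: leq_trans (leq_addr _ _) wiener_ge.
Qed.

Lemma lower_bound_ge5 : 5 <= r ->
  min_wiener n r <= wiener G /\ (wiener G = min_wiener n r -> extremal G).
Proof.
move=> r5; have [a rE] : exists a, r = a + 5 by exists (r - 5); lia.
have Lr : L + (a + 5) <= n.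
  by have := n_leaf_odd O; have := n_oddD G; rewrite rE; lia.
have hr' : 2 * (a + 5) <= n + 3 by rewrite -rE.
have -> : min_wiener n r = (n - (a + 5)) * (n - 1) + 2 * a * (n - 2) + 6 * n - 15.
  have a5 : a + 5 = a.+4.+1 by lia.
  rewrite rE a5 /min_wiener; congr (_ * _ + _ * _ + _ - _); lia.
have := @bound_ge5 n l L a (cyc_sum l) (or_size O) (size_c_le O)
  cycle_graph_small (cyc_sumE l) (n_leaf_c O) Lr hr'.
have := wiener_ge.
set m := _ - 15; set B := 2 * (L * _ + _) + _; set e := E => WB bnd.
split; first by lia.
move=> Wm; move: bnd; case: ifP => [/andP[/eqP l5 /eqP Ln]|_] bnd; last lia.
have short0 : ~~ short f c = 0 :> nat by lia.
apply: extremal5; rewrite ?rE //; last by rewrite -/e; lia.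
by case: short short0.
Qed.

Lemma lower_bound4 : r = 4 ->
  min_wiener n r <= wiener G /\ (wiener G = min_wiener n r -> extremal G).
Proof.
move=> rE; have -> : min_wiener n r = n * n - n - 4 by rewrite rE.
have oE := n_oddD G; have ev := even_n_odd O; have Lo := n_leaf_odd O.
have n6 : 6 <= n by move: hr; rewrite rE; lia.
have en : ~~ odd n by rewrite -oE rE oddD (negPf ev).
have nn : 6 * n <= n * n by rewrite leq_mul2r n6 orbT.
have Ln : L < n - 3 by lia.
have [l6|l5] := ltnP 5 l; first by apply: ltn_bound; have := wiener_gt_long l6; lia.
have l3 := or_size O.
have [l3'|] := eqVneq l 3; first by apply: ltn_bound; have := wiener_ge3 l3'; rewrite Ln; lia.
have [l4 _|l4 l3'] := eqVneq l 4.
  have := wiener_ge4 l4; set e := E => WB; split; first by lia.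
  by move=> Wm; apply: extremal4 => //; [move: WB; case: ltnP|rewrite -/e]; lia.
have l5' : l = 5 by lia.
have := wiener_ge5 l5'; set e := E => WB; split; first by lia.
by move=> Wm; apply: extremal5_K2 => //; rewrite -/e; lia.
Qed.

Lemma lower_bound23 : r = 2 \/ r = 3 ->
  min_wiener n r <= wiener G /\ (wiener G = min_wiener n r -> extremal G).
Proof.
move=> r23; have -> : min_wiener n r = n * n - 2 * n by case: r23 => ->.
have l3 := or_size O; have ln := size_c_le O; have sm := cycle_graph_small.
have nn : 3 * n <= n * n by rewrite leq_mul2r; lia.
have [l6|l5] := ltnP 5 l; first by apply: ltn_bound; have := wiener_gt_long l6; lia.
have [l3'|l3'] := eqVneq l 3.
  have := wiener_ge3 l3'; set e := E => WB; split; first by lia.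
  move=> Wm; apply: extremal3_even => //; last by rewrite -/e; lia.
  by rewrite l3'; move: WB; case: ltnP; lia.
have [l4|l4] := eqVneq l 4; first by apply: ltn_bound; have := wiener_ge4 l4; lia.
by have l5' : l = 5; [lia|apply: ltn_bound; have := wiener_ge5 l5'; lia].
Qed.

Lemma lower_bound1 : r = 1 ->
  min_wiener n r <= wiener G /\ (wiener G = min_wiener n r -> extremal G).
Proof.
move=> rE; have -> : min_wiener n r = n * n - n - 4 by rewrite rE.
have l3 := or_size O; have ln := size_c_le O; have sm := cycle_graph_small.
have oE := n_oddD G; have ev := even_n_odd O.
have [l3'|l3'] := eqVneq l 3; last first.
  have nn : 3 * n <= n * n by rewrite leq_mul2r; lia.
  (* Without [E] the four-cycle bound equals the target, so the positivity of [E] is what makes that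
     case strict. *)
  have E0 : 0 < E by rewrite lt0n; apply/eqP => /(not_concentrated rE); lia.
  have [l6|l5] := ltnP 5 l; first by apply: ltn_bound; have := wiener_gt_long l6; lia.
  have [l4|l4] := eqVneq l 4; first by apply: ltn_bound; have := wiener_ge4 l4; lia.
  by have l5' : l = 5; [lia|apply: ltn_bound; have := wiener_ge5 l5'; lia].
have w1 := sum_weight1_3 O l3'; have wn := sum_weight3 O l3'.
have [m1 m2] : w 1 <= w 0 /\ w 2 <= w 0 by split; apply: wmax; rewrite l3'.
have [p1 p2] : 0 < w 1 /\ 0 < w 2 by split; apply: weight_gt0; rewrite l3'.
rewrite rE in w1; have h0 : 1 < w 0 by lia.
have h12 : 2 < w 1 + w 2 by lia.
have [wle weq] := triangle_weights1 m1 m2 h0 p1 p2 h12.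
have := tree_part_ge_leaves; have := double_wienerE O; rewrite (cyc_part3 l3') l3'.
set P := w 0 * w 1 + _ + _ in wle weq *; rewrite wn in wle weq.
move=> WE T; have n3 : (n - 3) * (n - 1) + 4 * n = n * n + 3.
  by have [k ->] : exists k, n = k + 3; [exists (n - 3)|]; lia.
split; first by lia.
move=> Wm; have Peq : P + 7 = 3 * n by lia.
have Ln : n - l <= L by rewrite leqNgt l3'; apply/negP => lt; move: T; rewrite lt; lia.
apply: extremal3 => //; [|lia..].
(* By the handshake lemma n is odd, and [w 1 + w 2 = 3], so [w 0] is even. *)
by move: wn ev oE (weq Peq); rewrite rE; lia.
Qed.

Lemma lower_bound0 : r = 0 ->
  min_wiener n r <= wiener G /\ (wiener G = min_wiener n r -> extremal G).
Proof.
move=> rE; have -> : min_wiener n r = n * n - 9 by rewrite rE.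
have l3 := or_size O; have oE := n_oddD G; have ev := even_n_odd O.
have w2 := weight_ge2 O rE.
have T := tree_part_ge_leaves; have WE := double_wienerE O.
have [l3'|l3'] := eqVneq l 3; last first.
  have l4 : 4 <= l by lia.
  apply: ltn_bound; have := bound_zero l4 (weight2_n w2) (cyc_sumE l); have := cyc_part_ge2 w2; lia.
have wn := sum_weight3 O l3'.
have [m1 m2] : w 1 <= w 0 /\ w 2 <= w 0 by split; apply: wmax; rewrite l3'.
have [p1 p2] : 1 < w 1 /\ 1 < w 2 by split; apply: w2; rewrite l3'.
have [wle weq] := triangle_weights0 m1 m2 p1 p2.
move: T WE; rewrite (cyc_part3 l3') l3'.
set P := w 0 * w 1 + _ + _ in wle weq *; rewrite wn in wle weq.
move=> T WE; have n3 : (n - 3) * (n - 1) + 4 * n = n * n + 3.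
  by have [k ->] : exists k, n = k + 3; [exists (n - 3)|]; lia.
split; first by lia.
move=> Wm; have Peq : P + 12 = 4 * n by lia.
have Ln : n - l <= L by rewrite leqNgt l3'; apply/negP => lt; move: T; rewrite lt; lia.
apply: extremal3 => //; [|lia..].
(* Here n is even and [w 1 + w 2 = 4], so again [w 0] is even. *)
by move: wn ev oE (weq Peq); rewrite rE; lia.
Qed.

Lemma lower_bound :
  min_wiener n r <= wiener G /\ (wiener G = min_wiener n r -> extremal G).
Proof.
have [r5|] := leqP 5 r; first exact: lower_bound_ge5.
case rE: r => [|[|[|[|[|//]]]]] _; rewrite -rE.
- exact: lower_bound0.
- exact: lower_bound1.
- by apply: lower_bound23; left.
- by apply: lower_bound23; right.
- exact: lower_bound4.
Qed.

End Main.

(** Order and number of even vertices are isomorphism invariants, which forces n' = n and r' = r; no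
    branch number has to be solved for. *)
Lemma iso_optimal (G K : sgraph) n r n' r' : in_U n r G -> G ~= K ->
  optimal K n' r' -> wiener G = min_wiener n r.
Proof.
case=> _ <- <- GK [[_ <- <-] wK].
by rewrite (iso_wiener GK) (iso_card GK) (iso_even GK).
Qed.

Lemma extremal_wiener (G : sgraph) n r : in_U n r G -> extremal G ->
  wiener G = min_wiener n r.
Proof.
move=> GU [[iG|[b [X1 [X2 [_ ob hX1 hX2 iG]]]]]|[[b eb iG]|[b eb iG]|[b [S [eb]]]]].
- exact: iso_optimal GU iG optimal_H5_K2.
- exact: iso_optimal GU iG (optimal_H3_odd ob hX1 hX2).
- exact: iso_optimal GU iG (optimal_H3_even eb).
- exact: iso_optimal GU iG (optimal_H4 eb).
case=> ls [sz ls12 ->] iG; rewrite -sz in eb.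
exact: iso_optimal GU iG (optimal_H5 ls12 eb).
Qed.

Lemma in_U_orientation (G : sgraph) n r : in_U n r G ->
  exists (f : G -> G) (c : seq G) (O : orientation f c),
    forall i, i < size c -> weight O i <= weight O 0.
Proof.
by case=> /unicyclic_orientation[f [c /orientation_max[c' [O wmax]]]] _ _; exists f, c', O.
Qed.

(** The given member of the class supplies the parity of n - r and the least order for which the
    witness makes sense. *)
Lemma optimal_exists (G : sgraph) n r : in_U n r G -> 2 * r <= n + 3 ->
  exists K, optimal K n r.
Proof.
move=> GU hr; have [f [c [O wmax]]] := in_U_orientation GU.
case: GU => _ nE rE; have oE := n_oddD G; have ev := even_n_odd O.
have l3 := or_size O; have ln := size_c_le O.
rewrite -/(n_even G) in rE.
have wit K n' r' r0 : optimal K n' r' -> n' = n -> r' = r0 -> exists K, optimal K n r0.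
  by move=> oK <- <-; exists K.
case: r rE hr => [|[|[|[|[|a]]]]] rE hr.
- have n6 := weight2_n (weight_ge2 O rE).
  apply: wit (@optimal_H3_odd (n - 5) K2 K2 _ _ _) _ _; rewrite ?card_K2 //; try by right.
    lia.
  lia.
- have n5 : 5 <= n.
    have [l3'|] := eqVneq (size c) 3; last by lia.
    have wp i : i < 3 -> 0 < weight O i by rewrite -l3'; apply: weight_gt0.
    have := sum_weight1_3 O l3'; have := sum_weight3 O l3'; rewrite rE nE.
    by have := wp 0 isT; have := wp 1 isT; have := wp 2 isT; lia.
  apply: wit (@optimal_H3_odd (n - 4) K1 K2 _ _ _) _ _; rewrite ?card_K1 ?card_K2 //.
  + lia.
  + by left.
  + by right.
  lia.
- apply: wit (@optimal_H3_odd (n - 3) K1 K1 _ _ _) _ _; rewrite ?card_K1 //; try by left.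
    lia.
  lia.
- by apply: wit (@optimal_H3_even (n - 3) _) _ _; lia.
- by apply: wit (@optimal_H4 (n - 4) _) _ _; lia.
(* Among n - r branches, a = r - 5 are long; [hr] gives n - 2a - 5 >= 2, so the number of short ones
   is not truncated. *)
pose ls := nseq a 2 ++ nseq (n - a.+4.+1 - a) 1.
have sz : size ls = n - a.+4.+1 by rewrite size_cat !size_nseq; lia.
have sm : sumn ls = n - 5 by rewrite sumn_cat !sumn_nseq; lia.
apply: wit (@optimal_H5 ls _ _) _ _; rewrite ?sz ?sm; try lia.
by rewrite all_cat !all_nseq !orbT.
Qed.

Theorem theorem1p2 (n r : nat) (hr : 2 * r <= n + 3)
    (G : sgraph) (hG : in_U n r G) :
  (forall G' : sgraph, in_U n r G' -> wiener G <= wiener G') <->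
  ((* (a) *)
   (G ~= H [:: K2; K1; K1; K1; K1] \/
    exists (b1 : nat) (X1 X2 : rooted_graph),
      [/\ 1 <= b1, odd b1, X1 = K1 \/ X1 = K2, X2 = K1 \/ X2 = K2
        & G ~= H [:: SB 1 b1; X1; X2]])
   \/
   (* (b) *)
   [\/ exists2 b2 : nat, ~~ odd b2 & G ~= H [:: SB 1 b2; K1; K1],
       exists2 b3 : nat, ~~ odd b3 & G ~= H [:: SB 1 b3; K1; K1; K1]
     | exists (b4 : nat) (S : rooted_graph),
         [/\ ~~ odd b4, is_SaB 2 b4 S & G ~= H [:: S; K1; K1; K1; K1]]]).
Proof.
have lb K : in_U n r K ->
    min_wiener n r <= wiener K /\ (wiener K = min_wiener n r -> extremal K).
  move=> KU; have [f [c [O wmax]]] := in_U_orientation KU.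
  case: KU => _ nE rE; have := lower_bound wmax; rewrite /n_even nE rE; exact.
split=> [Gmin|exG G' G'U].
  have [K [KU wK]] := optimal_exists hG hr.
  have [le ext] := lb G hG; apply: ext; apply/eqP; rewrite eqn_leq le andbT -wK.
  exact: Gmin.
by rewrite (extremal_wiener hG exG); have [] := lb G' G'U.
Qed.
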